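(* Let $\mathbb{G}$ be a homogeneous Lie group of homogeneous dimension $Q$ and $|\cdot|$ any homogeneous quasi-norm. Let $1<p,q<\infty$, $0<r<\infty$ with $p+q\ge r$, $\delta\in[0,1]\cap\left[\frac{r-q}{r},\frac{p}{r}\right]$, and $\alpha,b,c\in\mathbb{R}$ with $\frac{\delta r}{p}+\frac{(1-\delta)r}{q}=1$ and $c=-\delta+b(1-\delta)$. Then for every complex-valued $f\in C_0^\infty(\mathbb{G}\setminus\{0\})$, $$\left|\frac{Q-\alpha}{p}\right|^\delta\left\||x|^{\alpha c/p}f\right\|_{L^r(\mathbb{G})}\le\left[\left\|\frac{\mathcal{R}_{|x|}f}{|x|^{\alpha/p-1}}\right\|_{L^p(\mathbb{G})}^p-\int_{\mathbb{G}}C_p\!\left(\frac{\mathcal{R}_{|x|}f}{|x|^{\alpha/p-1}},\frac{\mathcal{R}_{|x|}f}{|x|^{\alpha/p-1}}+\frac{Q-\alpha}{p}\frac{f}{|x|^{\alpha/p}}\right)dx\right]^{\delta/p}\left\||x|^{\alpha b/p}f\right\|_{L^q(\mathbb{G})}^{1-\delta}.$$ Moreover, when $\alpha\ne Q$, the constant $\left|\frac{Q-\alpha}{p}\right|^\delta$ is sharp for any homogeneous quasi-norm in the case $q=p$ with $b=-1$, and in the cases $\delta\in\{0,1\}$.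
   Context: A homogeneous Lie group is a connected simply connected (nilpotent) Lie group $\mathbb{G}$, identified with $\mathbb{R}^n$, whose Lie algebra carries dilations $D_\lambda=\exp(A\ln\lambda)$ with $A$ diagonalisable with positive eigenvalues and each $D_\lambda$ a Lie algebra automorphism, inducing dilations $x\mapsto\lambda x$ on $\mathbb{G}$; $Q=\operatorname{Tr}A$ and Haar (Lebesgue) measure satisfies $\int f(\lambda x)dx=\lambda^{-Q}\int fdx$. A homogeneous quasi-norm is a continuous $|\cdot|:\mathbb{G}\to[0,\infty)$ with $|x^{-1}|=|x|$, $|\lambda x|=\lambda|x|$, $|x|=0$ iff $x=0$. The radial derivative is $\mathcal{R}_{|x|}f(x)=\frac{d}{dr}f(ry)$ at $r=|x|$, $y=x/|x|$. For complex $\xi,\eta$, $C_p(\xi,\eta):=|\xi|^p-|\xi-\eta|^p-p|\xi-\eta|^{p-2}\operatorname{Re}((\xi-\eta)\overline{\eta})$ (last term $0$ when $\xi=\eta$). Sharp means the constant cannot be replaced by a larger one. *)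

(* Defs.v *)
From HB Require Import structures.
From mathcomp Require Import all_boot all_order all_algebra.
From mathcomp Require Import all_classical all_reals all_analysis.
From mathcomp Require Import complex.
Set Implicit Arguments. Unset Strict Implicit. Unset Printing Implicit Defensive.
Import Order.TTheory GRing.Theory Num.Theory.
Import numFieldNormedType.Exports.
Local Open Scope classical_set_scope.
Local Open Scope ring_scope.

Section Defs.
Context {R : realType}.

(* Lebesgue integral of a nonnegative (extended-real) function on R^n,
   R^n represented as row vectors 'rV[R]_n; defined as the iterated
   one-dimensional Lebesgue integral (equal to the integral against the
   n-dimensional Lebesgue measure for nonnegative measurable integrands,
   by Tonelli). *)
Fixpoint leb_int (n : nat) : ('rV[R]_n -> \bar R) -> \bar R :=
  match n return ('rV[R]_n -> \bar R) -> \bar R with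
  | 0 => fun g => g 0
  | n'.+1 => fun g =>
      (\int[@lebesgue_measure R]_t
         leb_int (fun y : 'rV[R]_n' => g (row_mx (\row_(_ < 1) t) y)))%E
  end.

(* Data of a homogeneous Lie group structure on R^n (exponential coordinates):
   a group law [mul] (identity 0, inverse x |-> -x) and the dilation
   generator A = P^-1 diag(nu) P (diagonalisable, eigenvalues nu_i). *)
Record hgroup (n : nat) := HGroup {
  hg_mul : 'rV[R]_n -> 'rV[R]_n -> 'rV[R]_n;
  hg_P : 'M[R]_n;
  hg_nu : 'I_n -> R }.

Definition hg_A n (G : hgroup n) : 'M[R]_n :=
  invmx (hg_P G) *m diag_mx (\row_i hg_nu G i) *m hg_P G.

(* D_lambda = exp(A ln lambda) = P^-1 diag(lambda^nu_i) P, acting on row vectors *)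
Definition dil n (G : hgroup n) (l : R) (x : 'rV[R]_n) : 'rV[R]_n :=
  x *m (invmx (hg_P G) *m diag_mx (\row_i (l `^ hg_nu G i)) *m hg_P G).

Definition hdim n (G : hgroup n) : R := \tr (hg_A G).

Definition is_homogeneous_group n (G : hgroup n) : Prop :=
  hg_P G \in unitmx /\
  (forall i, 0 < hg_nu G i) /\
  (forall x y z, hg_mul G x (hg_mul G y z) = hg_mul G (hg_mul G x y) z) /\
  (forall x, hg_mul G 0 x = x /\ hg_mul G x 0 = x) /\
  (forall x, hg_mul G x (- x) = 0 /\ hg_mul G (- x) x = 0) /\
  continuous (fun xy : 'rV[R]_n * 'rV[R]_n => hg_mul G xy.1 xy.2) /\
  (forall l x y, 0 < l -> dil G l (hg_mul G x y) = hg_mul G (dil G l x) (dil G l y)) /\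
  (* Lebesgue measure is the (left) Haar measure *)
  (forall (g : 'rV[R]_n -> R) y, continuous g -> (forall x, 0 <= g x) ->
     (exists K : set 'rV[R]_n, compact K /\ forall x, ~ K x -> g x = 0) ->
     leb_int (fun x => (g (hg_mul G y x))%:E) = leb_int (fun x => (g x)%:E)).

Definition is_quasi_norm n (G : hgroup n) (qn : 'rV[R]_n -> R) : Prop :=
  [/\ continuous qn,
      (forall x, 0 <= qn x),
      (forall x, qn (- x) = qn x),
      (forall l x, 0 < l -> qn (dil G l x) = l * qn x)
    & (forall x, qn x = 0 <-> x = 0)].

Fixpoint iter_dd n (vs : seq 'rV[R]_n) (g : 'rV[R]_n -> R) : 'rV[R]_n -> R :=
  match vs with
  | [::] => g
  | v :: vs' => fun x => 'D_v (iter_dd vs' g) x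
  end.

Definition smooth n (g : 'rV[R]_n -> R) : Prop :=
  forall vs : seq 'rV[R]_n,
    continuous (iter_dd vs g) /\ forall v x, derivable (iter_dd vs g) x v.

Definition C0inf_punct n (f : 'rV[R]_n -> R[i]) : Prop :=
  smooth (fun x => complex.Re (f x)) /\ smooth (fun x => complex.Im (f x)) /\
  exists K : set 'rV[R]_n, [/\ compact K, ~ K 0 & forall x, ~ K x -> f x = 0].

Definition toC (a : R) : R[i] := Complex a 0.

Definition radial n (G : hgroup n) (qn : 'rV[R]_n -> R) (f : 'rV[R]_n -> R[i])
  (x : 'rV[R]_n) : R[i] :=
  let y := dil G (qn x)^-1 x in
  Complex (derive1 (fun r => complex.Re (f (dil G r y))) (qn x))
          (derive1 (fun r => complex.Im (f (dil G r y))) (qn x)).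

Definition Cp (p : R) (xi eta : R[i]) : R :=
  if xi == eta then Normc.normc xi `^ p
  else Normc.normc xi `^ p - Normc.normc (xi - eta) `^ p
       - p * Normc.normc (xi - eta) `^ (p - 2) * complex.Re ((xi - eta) * conjc eta).

Definition Lnorm_ n (s : R) (g : 'rV[R]_n -> R) : R :=
  fine (leb_int (fun x => (`|g x| `^ s)%:E)) `^ s^-1.

End Defs.

(* Main.v *)
(** The inequality is an identity followed by Hoelder's inequality.  Put
[kappa = (Q - alpha) / p] and [eta - xi = kappa f |x|^(-alpha/p)].  Expanding [C_p],
the bracket on the right-hand side is [int |eta - xi|^p] up to a multiple of the defect
in the radial integration by parts
[p int |f|^(p-2) Re (f conj (E f)) |x|^-alpha = (alpha - Q) int |f|^p |x|^-alpha],
where [E = |x| R_|x|] is the generator of the dilations.  That formula is the derivative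
at [t = 0] of [int g (D_(e^t) x) dx = e^(-tQ) int g] for [g = |f|^p |x|^-alpha].
Hence the bracket equals [|kappa|^p int |f|^p |x|^-alpha], the inequality is the
interpolation of a weighted [L^r] norm between weighted [L^p] and [L^q] norms, and in the
three cases of the sharpness claim it is an equality for every [f].

All integrands are continuous with compact support, so the iterated integral [leb_int]
is only studied as a positive functional on such functions; its behaviour under linear
maps comes from the uniqueness argument for Haar measures. *)

Require Import Defs.
From HB Require Import structures.
From mathcomp Require Import all_boot all_order all_algebra.
From mathcomp Require Import all_classical all_reals all_analysis.
From mathcomp Require Import complex.
From mathcomp Require Import ring lra.
Import Order.TTheory GRing.Theory Num.Theory.
Import numFieldNormedType.Exports.
Local Open Scope ring_scope.
Set Implicit Arguments.
Unset Strict Implicit.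
Unset Printing Implicit Defensive.
Local Open Scope classical_set_scope.

(** * Compactly supported functions and the integral on the line *)

(** Three obstacles shape the proof. The dilations are diagonal only after conjugation by [hg_P G],
    whereas an iterated integral is transparent only under coordinatewise maps; the change of
    variables by [hg_P G] is known up to an unknown factor, which cancels because conjugation uses
    it once in each direction. Smoothness is given through directional derivatives, and for small
    [p] the function [|f|^p] is in general no better than [C^1] at the zeros of [f]; derivatives
    along the flow are therefore found through slope functions in the sense of Caratheodory, which
    ask for continuity and no remainder estimate. Differentiation under the integral sign rests on
    uniform convergence of difference quotients with a common bounded support, which is all that a
    positive functional on [Cc] can see. The weights [|x|^s], singular at the origin, stay harmless
    because [f] vanishes near it. Sharpness finally needs one nonzero test function, hence the
    explicit bump. *)

Definition Cc {R : realType} {V : normedModType R} (g : V -> R) : Prop :=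
  continuous g /\ exists M : R, forall x, M < `|x| -> g x = 0.

Section LineIntegral.
Context {R : realType}.
Local Notation mu := (@lebesgue_measure R).
Implicit Types g h : R -> R.

Lemma continuous_within (T U : topologicalType) (A : set T) (g : T -> U) :
  continuous g -> {within A, continuous g}.
Proof. by move=> cg; apply: continuous_subspaceT. Qed.

(** Both ends of the interval are left free, so that it may later be the image of a symmetric
    interval under an affine map. *)
Lemma Cc_supp_itv g : Cc g ->
  exists2 M : R, 0 < M & forall a b : R, a <= - M -> M <= b -> g \_ `[a, b] = g.
Proof.
case=> _ [M gM]; exists (`|M| + 1); first by rewrite ltr_wpDl.
move=> a b aM Mb; apply/funext => x; rewrite patchE.
case: ifPn => //; rewrite notin_setE /= in_itv /= => /negP.
rewrite negb_and -!ltNge => xab; rewrite gM //.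
case/orP: xab => [xa|bx].
  by rewrite -normrN; have := ler_norm (- x); have := ler_norm M; lra.
by have := ler_norm x; have := ler_norm M; lra.
Qed.

Lemma integral_supp g (A : set R) : g \_ A = g ->
  (\int[mu]_x (g x)%:E = \int[mu]_(x in A) (g x)%:E)%E.
Proof.
move=> gA; rewrite [RHS]integral_mkcond; apply: eq_integral => x _.
by rewrite -[in LHS]gA !patchE; case: ifP.
Qed.

Lemma Cc_integrable g : Cc g -> mu.-integrable setT (EFin \o g).
Proof.
move=> gC; have [M M0 gM] := Cc_supp_itv gC.
rewrite -(gM (- M) M) // -restrict_EFin.
apply: (iffLR (@integrable_mkcond _ _ _ mu `[- M, M] (EFin \o g) (measurable_itv _))).
apply: continuous_compact_integrable; first exact: segment_compact.
by apply: continuous_within; case: gC.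
Qed.

Lemma Rintegral_Cc_gt0 g x0 : Cc g -> (forall x, 0 <= g x) -> 0 < g x0 ->
  0 < \int[mu]_x g x.
Proof.
move=> gC g0 gx0; have gi := Cc_integrable gC.
have [cg _] := gC.
have e0 : 0 < g x0 / 2 by rewrite divr_gt0.
have /cvgrPdist_lt/(_ _ e0) := cg x0.
move=> /nbhs_ballP[d /= d0 dg].
pose A : set R := `[x0, x0 + d / 2].
have mA : measurable A by exact: measurable_itv.
have gA x : A x -> g x0 / 2 <= g x.
  rewrite /A /= in_itv /= => /andP[h1 h2].
  have : ball x0 d x by rewrite /ball /= distrC ger0_norm; lra.
  move/dg; rewrite distrC ltr_distl => /andP[h3 h4]; lra.
apply: (@lt_le_trans _ _ (\int[mu]_(x in A) (g x0 / 2))).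
  have muA : mu A = (d / 2)%:E.
    transitivity (mu [set` `[x0, x0 + d / 2]%R]) => //.
    by rewrite lebesgue_measure_itv /= lte_fin ltrDl divr_gt0 //= -EFinB addrAC subrr add0r.
  rewrite Rintegral_cst //; rewrite [X in fine X]muA /=.
  by rewrite mulr_gt0 // divr_gt0.
apply: (@le_trans _ _ (\int[mu]_(x in A) g x)).
  apply: le_Rintegral => //.
    by apply: continuous_compact_integrable;
      [exact: segment_compact|apply: continuous_within => ?; exact: cvg_cst].
  exact: integrableS gi.
rewrite /Rintegral fine_le //.
- by apply: integrable_fin_num => //; exact: integrableS gi.
- exact: integrable_fin_num.
- apply: ge0_subset_integral => //=; last by move=> x _; rewrite lee_fin.
  exact: (measurable_int mu gi).
Qed.

Lemma Rintegral_Cc_affine g (a b : R) : 0 < a -> Cc g ->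
  \int[mu]_x g (a * x + b) = a^-1 * \int[mu]_x g x.
Proof.
move=> a0 gC; have [M M0 gM] := Cc_supp_itv gC.
pose F x : R := a * x + b.
have dF (x : R) : is_derive x 1 F a.
  rewrite /F; apply: is_derive_eq; by rewrite /GRing.scale /=; ring.
have F' : F^`() = cst a by apply/funext => x; rewrite derive1E derive_val.
have cF : continuous F.
  move=> x; apply: differentiable_continuous.
  by apply/derivable1_diffP; exact: ex_derive.
have [cg _] := gC.
have gFC : Cc (g \o F).
  split; first by move=> x; apply: continuous_comp; [exact: cF|exact: cg].
  exists ((`|b| + M + 1) / a) => x; rewrite ltr_pdivrMr // => hx /=.
  rewrite -(gM (- M) M) // patchE ifF //; apply/negbTE.
  rewrite notin_setE /= in_itv /= => /andP[h1 h2].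
  have h3 : `|F x| <= M by rewrite ler_norml h1.
  have : `|x| * a = `|F x - b| by rewrite /F addrK normrM (gtr0_norm a0) mulrC.
  have := ler_normB (F x) b; lra.
have [N N0 gFN] := Cc_supp_itv gFC.
(* [K] is so large that [[-K, K]] contains the support of [g \o F] and that its image under [F]
   contains the support of [g]. *)
pose K := Num.max N ((`|b| + M) / a).
have NK : N <= K by rewrite le_max lexx.
have MK : `|b| + M <= a * K by rewrite mulrC -ler_pdivrMr // le_max lexx orbT.
have hsub := @integration_by_substitution_increasing R F g (- K) K.
have : (\int[mu]_x (g x)%:E = \int[mu]_x (a%:E * ((g \o F) x)%:E))%E.
  have bl := ler_norm b; have bl' := ler_norm (- b); rewrite normrN in bl'.
  rewrite (@integral_supp g `[F (- K), F K]); last by apply: gM; rewrite /F; lra.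
  rewrite hsub //; last first.
  - exact: continuous_within.
  - split.
    + by move=> x _; exact: ex_derive.
    + by apply: cvg_at_right_filter; exact: cF.
    + by apply: cvg_at_left_filter; exact: cF.
  - by rewrite F'; apply/cvg_ex; exists a; exact: cvg_cst.
  - by rewrite F'; apply/cvg_ex; exists a; exact: cvg_cst.
  - by rewrite F' => x _; exact: cvg_cst.
  - by move=> x y _ _ xy; rewrite /F ltrD2r ltr_pM2l.
  - lra.
  rewrite integral_mkcond; apply: eq_integral => x _.
  rewrite F' -[in RHS](gFN (- K) K) ?patchE; [|lra|lra].
  by case: ifP => _; rewrite /= -EFinM ?mulr0 // mulrC.
rewrite integralZl //; last exact: (Cc_integrable gFC).
rewrite /Rintegral => ->; rewrite fineM //=; last first.
  by apply: integrable_fin_num => //; exact: (Cc_integrable gFC).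
by rewrite mulrA mulVf ?mul1r // gt_eqF.
Qed.

Lemma Rintegral_CcN g : Cc g -> \int[mu]_x g (- x) = \int[mu]_x g x.
Proof.
move=> gC; have [M M0 gM] := Cc_supp_itv gC.
have [cg _] := gC.
rewrite /Rintegral; congr fine.
rewrite [RHS](@integral_supp g `[- M, - - M]); last by rewrite opprK; exact: gM.
rewrite integration_by_substitution_oppr; [|lra|exact: continuous_within].
rewrite [RHS]integral_mkcond; apply: eq_integral => x _.
rewrite -[in LHS](gM (- M) M) // !patchE /=.
have -> : (- x \in `[(- M), M]) = (x \in `[(- M), M]).
  by apply/idP/idP; rewrite !inE /= !in_itv /= => /andP[h1 h2]; apply/andP; lra.
by case: ifP.
Qed.

(** An open set of the plane is the union of the rational rectangles that it contains, a countable
    family; this places it in the product sigma-algebra, where Tonelli's theorem wants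
    measurability. *)
Lemma measurable_open_plane (U : set (R * R)) : open U ->
  measurable (U : set (measurableTypeR R * measurableTypeR R)).
Proof.
move=> oU.
pose B (q : (rat * rat) * (rat * rat)) : set (R * R) :=
  (`]ratr q.1.1, ratr q.1.2[ : set R) `*` (`]ratr q.2.1, ratr q.2.2[ : set R).
pose F q : set (R * R) := if pselect (B q `<=` U) is left _ then B q else set0.
have -> : U = \bigcup_q F q.
  apply/seteqP; split => [[x y] Uxy|z [q _]]; last first.
    by rewrite /F; case: pselect => // BU; exact: BU.
  have /nbhs_ballP[e /= e0 eU] : nbhs (x, y) U by exact: open_nbhs_nbhs.
  have e2 (z : R) : z - e < z by rewrite ltrBlDr ltrDl.
  have e3 (z : R) : z < z + e by rewrite ltrDl.
  have [q1] := rat_in_itvoo (e2 x); have [q2] := rat_in_itvoo (e3 x).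
  have [q3] := rat_in_itvoo (e2 y); have [q4] := rat_in_itvoo (e3 y).
  rewrite !in_itv /= => /andP[a1 a2] /andP[a3 a4] /andP[a5 a6] /andP[a7 a8].
  exists ((q1, q2), (q3, q4)) => //; rewrite /F; case: pselect => [_|[]].
    by split; rewrite /= in_itv /=; apply/andP.
  move=> [u v] [] /=; rewrite !in_itv /= => /andP[h1 h2] /andP[h3 h4].
  by apply: eU; split => /=; rewrite /ball /= ltr_distl; lra.
apply: countable_bigcupT_measurable; first exact: countableP.
move=> q; rewrite /F; case: pselect => _; last exact: measurable0.
by apply: measurableX; exact: measurable_itv.
Qed.

Lemma measurable_continuous_plane (k : R * R -> R) : continuous k ->
  measurable_fun setT
    (k : measurableTypeR R * measurableTypeR R -> measurableTypeR R).
Proof.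
move=> ck; apply: (measurability (@measurable_realfun.RGenOpens.G R)).
  exact: measurable_realfun.RGenOpens.measurableE.
move=> _ [_ [a [b ->]] <-]; rewrite setTI.
apply: measurable_open_plane; apply: open_comp; last exact: interval_open.
by move=> z _; exact: ck.
Qed.

End LineIntegral.

(** * Positive functionals *)

Section PositiveFunctional.
Context {R : realType}.
Implicit Types V W : normedModType R.

Lemma CcD V (g h : V -> R) : Cc g -> Cc h -> Cc (fun x => g x + h x).
Proof.
move=> [cg [M gM]] [ch [N hN]]; split.
  by move=> x; apply: (@continuousD _ _ _ g h x); [exact: cg|exact: ch].
exists (Num.max M N) => x; rewrite gt_max => /andP[h1 h2].
by rewrite gM // hN // addr0.
Qed.

Lemma CcMl V (g h : V -> R) : continuous h -> Cc g -> Cc (fun x => h x * g x).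
Proof.
move=> ch [cg [M gM]]; split.
  by move=> x; apply: (@continuousM _ _ h g x); [exact: ch|exact: cg].
by exists M => x /gM ->; rewrite mulr0.
Qed.

Lemma CcZ V (a : R) (g : V -> R) : Cc g -> Cc (fun x => a * g x).
Proof. by apply: CcMl => x; exact: cvg_cst. Qed.

Lemma CcB V (g h : V -> R) : Cc g -> Cc h -> Cc (fun x => g x - h x).
Proof.
move=> gC hC; have := CcD gC (CcZ (-1) hC).
by congr Cc; apply/funext => x; rewrite mulN1r.
Qed.

Lemma Cc_comp V W (g : V -> R) (f : W -> V) : continuous f ->
  (forall M : R, exists N : R, forall x, `|f x| <= M -> `|x| <= N) ->
  Cc g -> Cc (fun x => g (f x)).
Proof.
move=> cf pf [cg [M gM]]; split.
  by move=> x; apply: (@continuous_comp _ _ _ f g); [exact: cf|exact: cg].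
have [N fN] := pf M; exists N => x xN; apply: gM.
by rewrite ltNge; apply/negP => /fN; rewrite leNgt xN.
Qed.

(** Equal to [1] on the ball of radius [M] and to [0] outside radius [M + 1]. As functionals are
    controlled on [Cc] only, [L (cutoff M)] replaces the volume of the ball in estimates. *)
Definition cutoff V (M : R) (x : V) : R := Num.max 0 (Num.min 1 (M + 1 - `|x|)).

Lemma cutoff_ge0 V M (x : V) : 0 <= cutoff M x.
Proof. by rewrite le_max lexx. Qed.

Lemma cutoff_eq1 V M (x : V) : `|x| <= M -> cutoff M x = 1.
Proof.
move=> xM; rewrite /cutoff.
have -> : Num.min 1 (M + 1 - `|x|) = 1 by apply/min_idPl; lra.
by apply/max_idPr.
Qed.

Lemma Cc_cutoff V M : Cc (@cutoff V M).
Proof.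
split; last first.
  exists (M + 1) => x xM; apply/max_idPl; rewrite ge_min; apply/orP; right; lra.
move=> x; apply: (@continuous_max _ _ (cst 0) (fun x => Num.min 1 (M + 1 - `|x|))).
  exact: cvg_cst.
apply: (@continuous_min _ _ (cst 1) (fun x => (M + 1 - `|x|))).
  exact: cvg_cst.
by apply: continuousB; [exact: cvg_cst|exact: norm_continuous].
Qed.

(** The laws are asked on [Cc] only: the [fine] part of an extended-real integral need not be linear
    on arbitrary functions. *)
Definition pos_functional V (L : (V -> R) -> R) : Prop :=
  [/\ forall g h, Cc g -> Cc h -> L (fun x => g x + h x) = L g + L h,
      forall a g, Cc g -> L (fun x => a * g x) = a * L g &
      forall g, Cc g -> (forall x, 0 <= g x) -> 0 <= L g].

(** Turns the bounded support of [Cc] into a compact one. *)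
Definition compact_balls V := forall M : R, compact [set x : V | `|x| <= M].

Section Properties.
Variables (V : normedModType R) (L : (V -> R) -> R).
Hypothesis PL : pos_functional L.

Lemma pos_functionalB (g h : V -> R) : Cc g -> Cc h ->
  L (fun x => g x - h x) = L g - L h.
Proof.
move=> gC hC; case: PL => LD LZ _; rewrite -[in RHS]mulN1r -LZ // -LD //.
  by congr L; apply/funext => x; rewrite mulN1r.
exact: CcZ.
Qed.

Lemma pos_functional_le (g h : V -> R) : Cc g -> Cc h ->
  (forall x, g x <= h x) -> L g <= L h.
Proof.
move=> gC hC gh; rewrite -subr_ge0 -pos_functionalB //.
case: PL => _ _; apply; first exact: CcB.
by move=> x; rewrite subr_ge0.
Qed.

Lemma pos_functional_norm (g h : V -> R) : Cc g -> Cc h ->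
  (forall x, `|g x| <= h x) -> `|L g| <= L h.
Proof.
move=> gC hC gh; case: PL => _ LZ _.
rewrite ler_norml -mulN1r -LZ //; apply/andP; split; apply: pos_functional_le => //.
- exact: CcZ.
- by move=> x; have := gh x; rewrite ler_norml mulN1r => /andP[].
- by move=> x; have := gh x; rewrite ler_norml => /andP[].
Qed.

End Properties.

(** Joint continuity at the points [(t0, x)] becomes uniform in [x] by compactness of the ball of
    radius [M]; outside that ball both values vanish. *)
Lemma uniform_parameter (T : topologicalType) V (H : T -> V -> R) (t0 : T) (M : R) :
  compact_balls V ->
  (forall x, {for (t0, x), continuous (fun z : T * V => H z.1 z.2)}) ->
  (\forall t \near t0, forall x, M < `|x| -> H t x = 0) ->
  forall e : R, 0 < e -> \forall t \near t0, forall x, `|H t x - H t0 x| <= e.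
Proof.
move=> cV cH sH e e0.
have /compact_near_coveringP := cV M.
move=> /(_ T (nbhs t0) (fun t x => `|H t x - H t0 x| <= e) _) HK.
have {}HK : \forall t \near t0, forall x, `|x| <= M -> `|H t x - H t0 x| <= e.
  apply: HK => x _ /=.
  have e2 : 0 < e / 2 by rewrite divr_gt0.
  have /cvgrPdist_lt/(_ _ e2) /= [[A B] /= [At Bx] AB] := cH x.
  exists (B, A) => //= -[y t] /= [By At'].
  have t0A : A t0 by exact: nbhs_singleton.
  have h1 := AB (t, y) (conj At' By); have h2 := AB (t0, y) (conj t0A By).
  rewrite /= in h1 h2.
  rewrite [X in `|X|](_ : _ = (H t0 x - H t0 y) - (H t0 x - H t y)); last by ring.
  by apply: (le_trans (ler_normB _ _)); lra.
near=> t => x; have [xM|xM] := leP `|x| M; first by move: x xM; near: t.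
have s0 : forall x, M < `|x| -> H t0 x = 0 by exact: nbhs_singleton sH.
have st : forall x, M < `|x| -> H t x = 0 by near: t.
by rewrite s0 // st // subrr normr0 ltW.
Unshelve. all: by end_near. Qed.

(** Plays the part of dominated convergence: near [t0] the difference of [H t] and [H t0] is bounded
    by a small multiple of [cutoff M], and positivity passes this bound to [L]. *)
Lemma pos_functional_continuous (T : topologicalType) V (L : (V -> R) -> R)
    (H : T -> V -> R) (t0 : T) (M : R) :
  compact_balls V -> pos_functional L -> (forall t, Cc (H t)) ->
  (forall x, {for (t0, x), continuous (fun z : T * V => H z.1 z.2)}) ->
  (\forall t \near t0, forall x, M < `|x| -> H t x = 0) ->
  {for t0, continuous (fun t => L (H t))}.
Proof.
move=> cV PL HC cH sH; apply/cvgrPdist_le => e e0.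
have C0 : 0 <= L (cutoff M).
  by case: PL => _ _; apply; [exact: Cc_cutoff|exact: cutoff_ge0].
(* The added [1] keeps the denominator positive even if [L (cutoff M) = 0]. *)
pose e' := e / (L (cutoff M) + 1).
have e'0 : 0 < e' by rewrite divr_gt0 // ltr_wpDl.
have uH := uniform_parameter cV cH sH e'0.
near=> t.
rewrite distrC -(pos_functionalB PL) //.
apply: (@le_trans _ _ (L (fun x => e' * cutoff M x))).
  apply: (pos_functional_norm PL); [exact: CcB|apply: CcZ; exact: Cc_cutoff|].
  move=> x; have [xM|xM] := leP `|x| M.
    by rewrite cutoff_eq1 // mulr1; move: x {xM}; near: t.
  have s0 : forall x, M < `|x| -> H t0 x = 0 by exact: nbhs_singleton sH.
  have st : forall x, M < `|x| -> H t x = 0 by near: t.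
  by rewrite s0 // st // subrr normr0 mulr_ge0 ?cutoff_ge0 // ltW.
have [_ LZ _] := PL; rewrite LZ; last exact: Cc_cutoff.
rewrite /e' mulrAC ler_pdivrMr; last by rewrite ltr_wpDl.
by rewrite ler_pM2l // lerDl.
Unshelve. all: by end_near. Qed.

Lemma Cc_slice V W (k : V * W -> R) : Cc k -> forall x, Cc (fun y => k (x, y)).
Proof.
move=> kC x; apply: (Cc_comp (f := fun y => (x, y))) kC.
  by move=> y; apply: cvg_pair; [exact: cvg_cst|exact: cvg_id].
by move=> M; exists M => y; rewrite prod_normE ge_max => /andP[].
Qed.

Lemma Cc_swap V W (k : V * W -> R) : Cc k -> Cc (fun z : W * V => k (z.2, z.1)).
Proof.
apply: (Cc_comp (f := fun z : W * V => (z.2, z.1))).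
  by move=> z; apply: cvg_pair; [exact: cvg_snd|exact: cvg_fst].
by move=> M; exists M => y; rewrite !prod_normE !ge_max => /andP[-> ->].
Qed.

Lemma Cc_partial V W (L : (W -> R) -> R) (k : V * W -> R) :
  compact_balls W -> pos_functional L -> Cc k -> Cc (fun x => L (fun y => k (x, y))).
Proof.
move=> cW PL kC; have [ck [M kM]] := kC; split.
  move=> x; apply: (@pos_functional_continuous V W L (fun x y => k (x, y)) x M) => //.
  - exact: Cc_slice.
  - move=> y; have -> : (fun z : V * W => k (z.1, z.2)) = k.
      by apply/funext => -[].
    exact: ck.
  - near=> t => y yM; apply: kM; rewrite prod_normE lt_max yM orbT //.
exists M => x xM.
(* Writing the zero function as a multiple of a function in [Cc] lets homogeneity evaluate [L] on
   it. *)
have -> : (fun y => k (x, y)) = (fun y => 0 * cutoff M y).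
  by apply/funext => y; rewrite mul0r; apply: kM; rewrite prod_normE lt_max xM.
by have [_ LZ _] := PL; rewrite LZ ?mul0r //; exact: Cc_cutoff.
Unshelve. all: by end_near. Qed.

(** Fubini's theorem as a relation between functionals, so that it can be carried from the line to
    ['rV[R]_n] by induction. *)
Definition swaps V W (L : (V -> R) -> R) (L' : (W -> R) -> R) :=
  forall k : V * W -> R, Cc k ->
    L (fun x => L' (fun y => k (x, y))) = L' (fun y => L (fun x => k (x, y))).

Lemma compact_balls_line : compact_balls R.
Proof.
move=> M; have -> : [set x : R | `|x| <= M] = `[- M, M].
  by apply/seteqP; split => x /=; rewrite in_itv /= ler_norml.
exact: segment_compact.
Qed.

Definition line_int (g : R -> R) : R := \int[@lebesgue_measure R]_t g t.

Lemma pos_functional_line : pos_functional line_int.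
Proof.
split=> [g h gC hC|a g gC|g gC g0].
- by rewrite /line_int RintegralD //; exact: Cc_integrable.
- by rewrite /line_int RintegralZl //; exact: Cc_integrable.
- exact: Rintegral_ge0.
Qed.

Lemma EFin_line_int (g : R -> R) : Cc g ->
  (line_int g)%:E = (\int[@lebesgue_measure R]_t (g t)%:E)%E.
Proof.
move=> gC; rewrite fineK //; apply: integrable_fin_num => //.
exact: Cc_integrable.
Qed.

Lemma swaps_line : swaps line_int line_int.
Proof.
have pos (k : R * R -> R) : Cc k -> (forall z, 0 <= k z) ->
    line_int (fun x => line_int (fun y => k (x, y))) =
    line_int (fun y => line_int (fun x => k (x, y))).
  move=> kC k0; have PL := pos_functional_line; have cR := compact_balls_line.
  apply: EFin_inj; rewrite !EFin_line_int; last 2 first.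
    exact: (@Cc_partial _ _ _ _ cR PL (Cc_swap kC)).
    exact: (@Cc_partial _ _ _ k cR PL kC).
  under eq_integral do rewrite (EFin_line_int (@Cc_slice _ _ k kC _)).
  under [RHS]eq_integral do rewrite (EFin_line_int (@Cc_slice _ _ _ (Cc_swap kC) _)).
  apply: (@fubini_tonelli _ _ _ _ R (@lebesgue_measure R) (@lebesgue_measure R)
    (fun z => (k z)%:E)).
    apply/measurable_realfun.measurable_EFinP; apply: measurable_continuous_plane; by case: kC.
  by move=> z; rewrite lee_fin.
move=> k kC; have [ck [M kM]] := kC.
have PL := pos_functional_line; have cR := compact_balls_line.
(* Tonelli's theorem settles nonnegative integrands; positive and negative parts of [k] remain in
   [Cc] and reduce the general case to it. *)
pose kp z := Num.max 0 (k z); pose km z := Num.max 0 (- k z).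
have kpC : Cc kp.
  split; last by exists M => z /kM; rewrite /kp => ->; rewrite maxxx.
  by move=> z; apply: (@continuous_max _ _ (cst 0) k); [exact: cvg_cst|exact: ck].
have kmC : Cc km.
  split; last by exists M => z /kM; rewrite /km => ->; rewrite oppr0 maxxx.
  move=> z; apply: (@continuous_max _ _ (cst 0) (fun z => - k z)).
    exact: cvg_cst.
  by apply: continuousN; exact: ck.
have kE : k = (fun z => kp z - km z).
  apply/funext => z; rewrite /kp /km; have [h|h] := leP 0 (k z).
    rewrite (max_idPl _) ?subr0 //; lra.
  rewrite (max_idPr _); lra.
have split_int (k1 k2 : R * R -> R) : Cc k1 -> Cc k2 ->
    line_int (fun x => line_int (fun y => k1 (x, y) - k2 (x, y))) =
    line_int (fun x => line_int (fun y => k1 (x, y))) -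
    line_int (fun x => line_int (fun y => k2 (x, y))).
  move=> k1C k2C; rewrite -(pos_functionalB PL).
  - by congr line_int; apply/funext => x; rewrite (pos_functionalB PL) //; exact: Cc_slice.
  - exact: Cc_partial.
  - exact: Cc_partial.
rewrite kE split_int // (split_int (fun z => kp (z.2, z.1)) (fun z => km (z.2, z.1))).
- by congr (_ - _); apply: pos => // z; rewrite le_max lexx.
- exact: Cc_swap.
- exact: Cc_swap.
Qed.

End PositiveFunctional.

(** * The iterated integral on row vectors *)

Section RowIntegral.
Context {R : realType}.

Lemma rV_norm_le n (x : 'rV[R]_n) (M : R) : 0 <= M ->
  (forall i, `|x 0 i| <= M) -> `|x| <= M.
Proof.
move=> M0 xM; rewrite /Num.Def.normr /= mx_normrE; apply/bigmax_leP; split => // -[i j] _ /=.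
by rewrite (ord1 i).
Qed.

Lemma rV_coord_le n (x : 'rV[R]_n) i : `|x 0 i| <= `|x|.
Proof.
rewrite [leRHS]/Num.Def.normr /= mx_normrE.
exact: (le_bigmax _ (fun ij : 'I_1 * 'I_n => `|x ij.1 ij.2|) (0, i)).
Qed.

Lemma compact_balls_rV n : compact_balls 'rV[R]_n.
Proof.
move=> M; apply: bounded_closed_compact.
  exists M; split; first exact: num_real.
  by move=> N MN x /= xM; rewrite (le_trans xM) // ltW.
have -> : [set x : 'rV[R]_n | `|x| <= M] = (fun x : 'rV[R]_n => `|x|) @^-1` [set y | y <= M].
  by [].
by apply: closed_comp; [move=> x _; exact: norm_continuous|exact: closed_le].
Qed.

Lemma cvg_rV n (T : Type) (F : set_system T) (FF : Filter F)
    (f : T -> 'rV[R]_n) (l : 'rV[R]_n) :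
  (forall i, f x 0 i @[x --> F] --> l 0 i) -> f x @[x --> F] --> l.
Proof.
move=> fl; apply/cvgrPdist_le => e e0; near=> t.
apply: rV_norm_le; first exact: ltW.
move=> i; rewrite !mxE; move: i; near: t; apply: filter_forall => i.
by have /cvgrPdist_le/(_ _ e0) := fl i.
Unshelve. all: by end_near. Qed.

Definition rV_cons n (t : R) (y : 'rV[R]_n) : 'rV[R]_n.+1 :=
  row_mx (\row_(_ < 1) t) y.

Lemma rV_cons0 n t (y : 'rV[R]_n) : rV_cons t y 0 0 = t.
Proof.
have -> : (0 : 'I_n.+1) = lshift n (0 : 'I_1) by exact: val_inj.
by apply: (etrans (@row_mxEl R 1 1 n (\row__ t) y 0 0)); rewrite mxE.
Qed.

Lemma rV_consS n t (y : 'rV[R]_n) i : rV_cons t y 0 (lift 0 i) = y 0 i.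
Proof.
have -> : (lift 0 i : 'I_n.+1) = rshift 1 i by exact: val_inj.
exact: (@row_mxEr R 1 1 n (\row__ t) y 0 i).
Qed.

Lemma rV_consK n (x : 'rV[R]_n.+1) : rV_cons (x 0 0) (\row_i x 0 (lift 0 i)) = x.
Proof.
apply/rowP => i; case: (unliftP 0 i) => [j ->|->]; last by rewrite rV_cons0.
by rewrite rV_consS mxE.
Qed.

Lemma rV_cons_norm n t (y : 'rV[R]_n) : `|rV_cons t y| = Num.max `|t| `|y|.
Proof.
apply/eqP; rewrite eq_le; apply/andP; split.
  apply: rV_norm_le; first by rewrite le_max normr_ge0.
  move=> i; case: (unliftP 0 i) => [j ->|->].
    by rewrite rV_consS le_max rV_coord_le orbT.
  by rewrite rV_cons0 le_max lexx.
rewrite ge_max; apply/andP; split.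
  by rewrite -[in leLHS](rV_cons0 t y) rV_coord_le.
by apply: rV_norm_le => // i; rewrite -(rV_consS t) rV_coord_le.
Qed.

Lemma continuous_rV_cons n : continuous (fun z : R * 'rV[R]_n => rV_cons z.1 z.2).
Proof.
move=> z; apply: cvg_rV => i; case: (unliftP 0 i) => [j ->|->].
  under eq_fun do rewrite rV_consS; rewrite rV_consS.
  apply: (@continuous_comp _ _ _ (fun z : R * 'rV[R]_n => z.2) (fun y => y 0 j)).
    exact: cvg_snd.
  exact: coord_continuous.
by under eq_fun do rewrite rV_cons0; rewrite rV_cons0; exact: cvg_fst.
Qed.

Lemma continuous_at_pair (T U W : topologicalType) (f : T -> U) (g : T -> W) x :
  {for x, continuous f} -> {for x, continuous g} ->
  {for x, continuous (fun x => (f x, g x))}.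
Proof. by move=> cf cg; apply: cvg_pair; [exact: cf|exact: cg]. Qed.

Lemma continuous_pair (T U W : topologicalType) (f : T -> U) (g : T -> W) :
  continuous f -> continuous g -> continuous (fun x => (f x, g x)).
Proof. by move=> cf cg x; apply: continuous_at_pair; [exact: cf|exact: cg]. Qed.

Lemma continuous_compose (T U W : topologicalType) (f : T -> U) (g : U -> W) :
  continuous f -> continuous g -> continuous (fun x => g (f x)).
Proof.
by move=> cf cg x; apply: (@continuous_comp _ _ _ f g); [exact: cf|exact: cg].
Qed.

Lemma continuous_fst (T U : topologicalType) : continuous (fst : T * U -> T).
Proof. by move=> x; exact: cvg_fst. Qed.

Lemma continuous_snd (T U : topologicalType) : continuous (snd : T * U -> U).
Proof. by move=> x; exact: cvg_snd. Qed.

(** The first coordinate is regrouped with the outer variable, the shape in which the integral over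
    the remaining coordinates is a partial integral. *)
Lemma Cc_rV_cons n (V : normedModType R) (k : V * 'rV[R]_n.+1 -> R) : Cc k ->
  Cc (fun z : (V * R) * 'rV[R]_n => k (z.1.1, rV_cons z.1.2 z.2)).
Proof.
apply: (Cc_comp (f := fun z : (V * R) * 'rV[R]_n => (z.1.1, rV_cons z.1.2 z.2))).
  have c1 : continuous (fun z : (V * R) * 'rV[R]_n => z.1.1).
    exact: (continuous_compose (@continuous_fst _ _) (@continuous_fst _ _)).
  have c2 : continuous (fun z : (V * R) * 'rV[R]_n => z.1.2).
    exact: (continuous_compose (@continuous_fst _ _) (@continuous_snd _ _)).
  apply: continuous_pair => //.
  exact: (continuous_compose (continuous_pair c2 (@continuous_snd _ _))
    (@continuous_rV_cons n)).
move=> M; exists M => z; rewrite !prod_normE /= rV_cons_norm !ge_max.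
by move=> /andP[-> /andP[-> ->]].
Qed.

Lemma Cc_rV_cons1 n (g : 'rV[R]_n.+1 -> R) : Cc g ->
  Cc (fun z : R * 'rV[R]_n => g (rV_cons z.1 z.2)).
Proof.
apply: (Cc_comp (f := fun z : R * 'rV[R]_n => rV_cons z.1 z.2)).
  exact: continuous_rV_cons.
by move=> M; exists M => z; rewrite rV_cons_norm prod_normE.
Qed.

Definition rV_int n (g : 'rV[R]_n -> R) : R := fine (leb_int (fun x => (g x)%:E)).

(** Both claims need a common induction: the inner integral lies in [Cc] as a function of the first
    coordinate because [rV_int] is a positive functional in the lower dimension, and this makes the
    outer integral finite. *)
Lemma rV_int_spec n : pos_functional (@rV_int n) /\
  forall g : 'rV[R]_n -> R, Cc g -> leb_int (fun x => (g x)%:E) = (rV_int g)%:E.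
Proof.
elim: n => [|n [PL fin]].
  by split => //; split => // g gC g0; exact: g0.
have S (g : 'rV[R]_n.+1 -> R) : Cc g ->
    leb_int (fun x => (g x)%:E) =
    (line_int (fun t => rV_int (fun y => g (rV_cons t y))))%:E.
  move=> gC; have gC1 := Cc_rV_cons1 gC.
  rewrite EFin_line_int; last exact: (Cc_partial (@compact_balls_rV n) PL gC1).
  apply: eq_integral => t _; rewrite -fin //.
  exact: (Cc_slice gC1).
have S' (g : 'rV[R]_n.+1 -> R) : Cc g ->
    rV_int g = line_int (fun t => rV_int (fun y => g (rV_cons t y))).
  by move=> gC; rewrite /rV_int S.
have [LD LZ L0] := PL; have [lD lZ l0] := @pos_functional_line R.
have P (g : 'rV[R]_n.+1 -> R) : Cc g -> Cc (fun t => rV_int (fun y => g (rV_cons t y))).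
  by move=> gC; exact: (Cc_partial (@compact_balls_rV n) PL (Cc_rV_cons1 gC)).
have Q (g : 'rV[R]_n.+1 -> R) : Cc g -> forall t, Cc (fun y => g (rV_cons t y)).
  by move=> gC t; exact: (Cc_slice (Cc_rV_cons1 gC)).
split; last by move=> g gC; rewrite S // S'.
split=> [g h gC hC|a g gC|g gC g0].
- rewrite !S' //; last exact: CcD.
  rewrite -lD; [|exact: P|exact: P]; congr line_int; apply/funext => t.
  by apply: LD; exact: Q.
- rewrite !S' //; last exact: CcZ.
  rewrite -lZ; last exact: P.
  by congr line_int; apply/funext => t; apply: LZ; exact: Q.
- rewrite S' //; apply: l0; first exact: P.
  by move=> t; apply: L0 => //; exact: Q.
Qed.

Lemma pos_functional_rV n : pos_functional (@rV_int n).
Proof. by case: (rV_int_spec n). Qed.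

Lemma leb_int_Cc n (g : 'rV[R]_n -> R) : Cc g ->
  leb_int (fun x => (g x)%:E) = (rV_int g)%:E.
Proof. by case: (rV_int_spec n) => _; apply. Qed.

Lemma rV_intS n (g : 'rV[R]_n.+1 -> R) : Cc g ->
  rV_int g = line_int (fun t => rV_int (fun y => g (rV_cons t y))).
Proof.
move=> gC; apply: EFin_inj; have gC1 := Cc_rV_cons1 gC.
rewrite -leb_int_Cc // EFin_line_int.
  by apply: eq_integral => t _; rewrite -leb_int_Cc //; exact: (Cc_slice gC1).
exact: (Cc_partial (@compact_balls_rV n) (pos_functional_rV n) gC1).
Qed.

Lemma rV_int_gt0 n (g : 'rV[R]_n -> R) x0 : Cc g -> (forall x, 0 <= g x) ->
  0 < g x0 -> 0 < rV_int g.
Proof.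
elim: n g x0 => [|n IH] g x0 gC g0 gx0.
  by rewrite /rV_int /= (_ : 0 = x0) //; apply/rowP => -[].
have gC1 := Cc_rV_cons1 gC.
rewrite rV_intS //; apply: (@Rintegral_Cc_gt0 _ _ (x0 0 0)).
- exact: (Cc_partial (@compact_balls_rV n) (pos_functional_rV n) gC1).
- move=> t; have [_ _ L0] := pos_functional_rV n; apply: L0 => //.
  exact: (Cc_slice gC1).
apply: (IH _ (\row_i x0 0 (lift 0 i))) => //; first exact: (Cc_slice gC1).
by rewrite rV_consK.
Qed.

Lemma swaps_rV (V : normedModType R) (L : (V -> R) -> R) n :
  compact_balls V -> pos_functional L -> swaps L (@line_int R) ->
  swaps L (@rV_int n).
Proof.
move=> cV PL sL; elim: n => [|n IH] k kC; first by [].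
have PR := pos_functional_rV n; have cR := @compact_balls_rV n.
have kC1 := Cc_rV_cons kC.
transitivity (L (fun x => line_int (fun t => rV_int (fun y => k (x, rV_cons t y))))).
  congr L; apply/funext => x; apply: rV_intS; exact: Cc_slice.
rewrite (sL (fun z : V * R => rV_int (fun y => k (z.1, rV_cons z.2 y)))); last first.
  exact: (Cc_partial cR PR kC1).
rewrite rV_intS; last exact: (Cc_partial cV PL (Cc_swap kC)).
congr line_int; apply/funext => t.
apply: (IH (fun z : V * 'rV[R]_n => k (z.1, rV_cons t z.2))).
apply: (Cc_comp (f := fun z : V * 'rV[R]_n => ((z.1, t), z.2))) kC1.
  apply: continuous_pair; last exact: continuous_snd.
  by apply: continuous_pair; [exact: continuous_fst|move=> z; exact: cvg_cst].
by move=> M; exists M => z; rewrite !prod_normE /= !ge_max => /andP[/andP[-> _] ->].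
Qed.

Lemma swaps_sym (V W : normedModType R) (L : (V -> R) -> R) (L' : (W -> R) -> R) :
  swaps L L' -> swaps L' L.
Proof. by move=> s k kC; rewrite (s _ (Cc_swap kC)). Qed.

(** [swaps_rV] is used twice: it extends line against line to row vectors against line, and after
    exchanging the two sides it extends the other factor. *)
Lemma swaps_rV_rV m n : swaps (@rV_int m) (@rV_int n).
Proof.
apply: swaps_rV; [exact: compact_balls_rV|exact: pos_functional_rV|].
apply: swaps_sym; apply: swaps_rV; [exact: compact_balls_line|
  exact: pos_functional_line|exact: swaps_line].
Qed.

End RowIntegral.

(** * Linear changes of variables and the dilation flow *)

Section LinearChange.
Context {R : realType}.

Lemma continuous_add (T : topologicalType) (f g : T -> R) :
  continuous f -> continuous g -> continuous (fun x => f x + g x).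
Proof. by move=> cf cg x; apply: cvgD; [exact: cf|exact: cg]. Qed.

Lemma continuous_mul (T : topologicalType) (f g : T -> R) :
  continuous f -> continuous g -> continuous (fun x => f x * g x).
Proof. by move=> cf cg x; apply: cvgM; [exact: cf|exact: cg]. Qed.

Lemma continuous_rV n (T : topologicalType) (f : T -> 'rV[R]_n) :
  (forall i, continuous (fun t => f t 0 i)) -> continuous f.
Proof. by move=> cf t; apply: cvg_rV => i; exact: cf. Qed.

(** Scaling and translation of each coordinate are done in a single induction, since both reduce to
    the same affine substitution on the line. *)
Lemma rV_int_affine n (d a : 'I_n -> R) (g : 'rV[R]_n -> R) :
  (forall i, 0 < d i) -> Cc g ->
  rV_int (fun x => g (\row_i (d i * x 0 i + a i))) = (\prod_i d i)^-1 * rV_int g.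
Proof.
elim: n d a g => [|n IH] d a g d0 gC.
  rewrite big_ord0 invr1 mul1r; congr rV_int; apply/funext => x; congr g.
  by apply/rowP => -[].
have affC : Cc (fun x : 'rV[R]_n.+1 => g (\row_i (d i * x 0 i + a i))).
  apply: (Cc_comp (f := fun x : 'rV[R]_n.+1 => \row_i (d i * x 0 i + a i))) gC.
    apply: continuous_rV => i.
    have -> : (fun x : 'rV[R]_n.+1 => (\row_i (d i * x 0 i + a i)) 0 i) =
      (fun x => d i * x 0 i + a i) by apply/funext => x; rewrite mxE.
    apply: continuous_add; last exact: cst_continuous.
    by apply: continuous_mul; [exact: cst_continuous|exact: coord_continuous].
  move=> M; exists (\sum_i (`|M| + `|a i|) / d i) => x xM.
  apply: rV_norm_le.
    by apply: sumr_ge0 => i _; rewrite divr_ge0 ?addr_ge0 // ltW.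
  move=> i; apply: (@le_trans _ _ ((`|M| + `|a i|) / d i)); last first.
    rewrite (bigD1 i) //= lerDl; apply: sumr_ge0 => j _.
    by rewrite divr_ge0 ?addr_ge0 // ltW.
  rewrite ler_pdivlMr // -[X in _ * X]gtr0_norm // -normrM mulrC.
  have := rV_coord_le (\row_i (d i * x 0 i + a i)) i; rewrite mxE => h.
  have := ler_normB (d i * x 0 i + a i) (a i); rewrite addrK => h'.
  by have := ler_norm M; lra.
rewrite rV_intS //.
pose G t := rV_int (fun y : 'rV[R]_n => g (rV_cons t y)).
have gC1 := Cc_rV_cons1 gC.
have GC : Cc G by exact: (Cc_partial (@compact_balls_rV R n) (pos_functional_rV n) gC1).
transitivity (line_int (fun t =>
    (\prod_(i < n) d (lift 0 i))^-1 * G (d 0 * t + a 0))).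
  congr line_int; apply/funext => t.
  rewrite /G -(IH _ (fun i => a (lift 0 i))) //; last exact: (Cc_slice gC1).
  congr rV_int; apply/funext => y; congr g; apply/rowP => i; rewrite mxE.
  case: (unliftP 0 i) => [j ->|->]; last by rewrite !rV_cons0.
  by rewrite !rV_consS mxE.
have [_ lZ _] := @pos_functional_line R.
rewrite lZ; last first.
  apply: (Cc_comp (f := fun t : R => d 0 * t + a 0)) GC.
    apply: continuous_add; last exact: cst_continuous.
    by apply: continuous_mul; [exact: cst_continuous|move=> t; exact: cvg_id].
  move=> M; exists ((M + `|a 0|) / d 0) => t tM.
  rewrite ler_pdivlMr // -[X in _ * X]gtr0_norm // -normrM mulrC.
  by have := ler_normB (d 0 * t + a 0) (a 0); rewrite addrK; lra.
rewrite /line_int (Rintegral_Cc_affine _ (d0 0) GC).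
by rewrite big_ord_recl /= invfM -mulrA mulrCA rV_intS.
Qed.

Lemma rV_int_translate n (a : 'rV[R]_n) (g : 'rV[R]_n -> R) : Cc g ->
  rV_int (fun x => g (x + a)) = rV_int g.
Proof.
move=> gC; have := @rV_int_affine n (fun=> 1) (fun i => a 0 i) g.
rewrite big1 // invr1 mul1r => <- //.
by congr rV_int; apply/funext => x; congr g; apply/rowP => i; rewrite !mxE mul1r.
Qed.

Lemma rV_int_scale n (d : 'I_n -> R) (g : 'rV[R]_n -> R) :
  (forall i, 0 < d i) -> Cc g ->
  rV_int (fun x => g (\row_i (x 0 i * d i))) = (\prod_i d i)^-1 * rV_int g.
Proof.
move=> d0 gC; rewrite -(rV_int_affine (fun=> 0)) //.
congr rV_int; apply/funext => x; congr g; apply/rowP => i.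
by rewrite !mxE addr0 mulrC.
Qed.

Lemma CcN (V : normedModType R) (g : V -> R) : Cc g -> Cc (fun x => g (- x)).
Proof.
apply: (Cc_comp (f := fun x : V => - x)); first by move=> x; exact: opp_continuous.
by move=> M; exists M => x; rewrite normrN.
Qed.

Lemma Cc_translate (V : normedModType R) (g : V -> R) a : Cc g ->
  Cc (fun x => g (x + a)).
Proof.
apply: (Cc_comp (f := fun x : V => x + a)).
  by move=> x; apply: cvgD; [exact: cvg_id|exact: cvg_cst].
move=> M; exists (M + `|a|) => x xM.
by have := ler_normB (x + a) a; rewrite addrK; lra.
Qed.

Lemma rV_intN n (g : 'rV[R]_n -> R) : Cc g -> rV_int (fun x => g (- x)) = rV_int g.
Proof.
elim: n g => [|n IH] g gC.
  by congr rV_int; apply/funext => x; congr g; apply/rowP => -[].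
rewrite rV_intS; last exact: CcN.
have gC1 := Cc_rV_cons1 gC.
rewrite rV_intS // -[RHS]Rintegral_CcN; last first.
  exact: (Cc_partial (@compact_balls_rV R n) (pos_functional_rV n) gC1).
congr line_int; apply/funext => t.
rewrite -[RHS]IH; last exact: (Cc_slice gC1).
congr rV_int; apply/funext => y; congr g; apply/rowP => i; rewrite [LHS]mxE.
case: (unliftP 0 i) => [j ->|->]; last by rewrite !rV_cons0.
by rewrite !rV_consS mxE.
Qed.

Lemma mulmx_norm_le m n (B : 'M[R]_(m, n)) : exists2 C : R, 0 <= C &
  forall x : 'rV[R]_m, `|x *m B| <= C * `|x|.
Proof.
exists (\sum_i \sum_j `|B i j|).
  by apply: sumr_ge0 => i _; apply: sumr_ge0.
move=> x; apply: rV_norm_le.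
  by apply: mulr_ge0 => //; apply: sumr_ge0 => i _; apply: sumr_ge0.
move=> j; rewrite mxE (le_trans (ler_norm_sum _ _ _)) // mulr_suml.
apply: ler_sum => i _; rewrite normrM mulrC; apply: ler_pM => //.
  by rewrite (bigD1 j) //= lerDl sumr_ge0.
exact: rV_coord_le.
Qed.

Lemma continuous_mulmx (T : topologicalType) m n (f : T -> 'rV[R]_m)
    (B : T -> 'M[R]_(m, n)) :
  continuous f -> (forall i j, continuous (fun t => B t i j)) ->
  continuous (fun t => f t *m B t).
Proof.
move=> cf cB t; apply: cvg_rV => j; under eq_fun do rewrite mxE; rewrite mxE.
apply: cvg_big; first exact: add_continuous.
move=> i _; apply: cvgM; last exact: cB.
exact: (continuous_compose cf (@coord_continuous _ _ _ _ _)).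
Qed.

Lemma continuous_mulmxr m n (B : 'M[R]_(m, n)) :
  continuous (fun x : 'rV[R]_m => x *m B).
Proof.
apply: (@continuous_mulmx _ m n id (fun=> B)) => [x|i j]; first exact: cvg_id.
exact: cst_continuous.
Qed.

Lemma unitmx_proper n (B : 'M[R]_n) : B \in unitmx ->
  forall M : R, exists N : R, forall x : 'rV[R]_n, `|x *m B| <= M -> `|x| <= N.
Proof.
move=> uB M; have [C C0 hC] := mulmx_norm_le (invmx B).
exists (C * M) => x xM; have := hC (x *m B); rewrite mulmxK // => h.
by apply: (le_trans h); rewrite ler_wpM2l.
Qed.

Lemma Cc_mulmx n (B : 'M[R]_n) (g : 'rV[R]_n -> R) : B \in unitmx -> Cc g ->
  Cc (fun x => g (x *m B)).
Proof.
move=> uB; apply: (Cc_comp (f := fun x : 'rV[R]_n => x *m B)).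
  exact: continuous_mulmxr.
exact: unitmx_proper.
Qed.

(* Uniqueness of Haar measure: [J g := rV_int (fun x => g (x *m B))] is translation
   invariant, so Fubini applied to [g x * h (y *m B - x)] gives
   [rV_int g * J h = rV_int h * J g]. *)
Lemma rV_int_mulmx n (B : 'M[R]_n) : B \in unitmx -> exists c : R,
  forall g, Cc g -> rV_int (fun x => g (x *m B)) = c * rV_int g.
Proof.
move=> uB; pose S (g h : 'rV[R]_n -> R) :=
  rV_int (fun y => rV_int (fun x => g x * h (y *m B - x))).
have [_ LZ _] := @pos_functional_rV R n.
have SE g h : Cc g -> Cc h -> rV_int g * rV_int (fun x => h (x *m B)) = S g h.
  move=> gC hC; have hBC := Cc_mulmx uB hC.
  rewrite /S -(@swaps_rV_rV R n n (fun z => g z.1 * h (z.2 *m B - z.1))).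
    rewrite mulrC -LZ //; congr rV_int; apply/funext => x /=.
    rewrite LZ; last first.
      have := Cc_translate (- (x *m invmx B)) hBC; congr Cc.
      by apply/funext => y; rewrite mulmxBl mulmxKV.
    rewrite mulrC; congr (_ * _); rewrite -(rV_int_translate (- (x *m invmx B))) //.
    by congr rV_int; apply/funext => y; rewrite mulmxBl mulmxKV.
  have [cg [M gM]] := gC; have [ch [N hN]] := hC.
  split.
    move=> z; apply: continuousM.
      exact: (continuous_compose (@continuous_fst _ _) cg).
    apply: (@continuous_compose _ _ _ (fun z : 'rV[R]_n * 'rV[R]_n => z.2 *m B - z.1) h) => //.
    move=> w; apply: cvgB; last exact: cvg_fst.
    exact: (continuous_compose (@continuous_snd _ _) (@continuous_mulmxr n n B)).
  have [K hK] := unitmx_proper uB (M + N).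
  exists (Num.max M K) => -[x y]; rewrite prod_normE /= lt_max !gt_max => xy.
  have [xM|xM] := ltP M `|x|; first by rewrite gM // mul0r.
  have [yN|yN] := ltP N `|y *m B - x|; first by rewrite hN // mulr0.
  have {}hK : `|y| <= K.
    apply: hK; have := ler_normD (y *m B - x) x; rewrite subrK; lra.
  by move: xy; rewrite !ltNge xM hK /= andbF.
(* The substitution of [y *m B - x] for [x], a reflection followed by a translation, exchanges the
   roles of [g] and [h]. *)
have Ssym g h : Cc g -> Cc h -> S g h = S h g.
  move=> gC hC; congr rV_int; apply/funext => y.
  have [cg _] := gC; have [ch _] := hC.
  have kC : Cc (fun x => h x * g (y *m B - x)).
    suff -> : (fun x => h x * g (y *m B - x)) = (fun x => g (- (x - y *m B)) * h x).
      apply: CcMl => //.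
      by have [] := Cc_translate (- (y *m B)) (CcN gC).
    by apply/funext => x; rewrite opprB mulrC.
  rewrite -[RHS](rV_intN kC) -[RHS](rV_int_translate (- (y *m B)) (CcN kC)).
  congr rV_int; apply/funext => x; rewrite opprB mulrC; congr (h _ * g _).
  by rewrite opprB addrC subrK.
pose chi := @cutoff R 'rV[R]_n 0.
have chiC : Cc chi by exact: Cc_cutoff.
have chi0 : 0 < rV_int chi.
  apply: (@rV_int_gt0 _ _ _ 0) => //; first by move=> x; exact: cutoff_ge0.
  by rewrite /chi cutoff_eq1 ?normr0.
exists (rV_int (fun x => chi (x *m B)) / rV_int chi) => g gC.
apply: (@mulfI _ (rV_int chi)); first by rewrite gt_eqF.
rewrite SE // Ssym // -SE // mulrCA mulrA mulrC.
by rewrite divfK ?gt_eqF.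
Qed.

End LinearChange.

(** * The dilations as a flow in logarithmic time *)

Section Flow.
Context {R : realType} (n : nat) (G : @hgroup R n).
Hypothesis Pu : hg_P G \in unitmx.

(** This is [dil G (expR t)], that is [exp (t A)]: an additive one-parameter group over all real
    times, whose derivative in [t] is the Euler operator. *)
Definition flow (t : R) (x : 'rV[R]_n) : 'rV[R]_n :=
  x *m (invmx (hg_P G) *m diag_mx (\row_i expR (t * hg_nu G i)) *m hg_P G).

Lemma dil_flow (l : R) x : 0 < l -> dil G l x = flow (ln l) x.
Proof.
move=> l0; rewrite /dil /flow; congr (_ *m (_ *m diag_mx _ *m _)).
by apply/rowP => i; rewrite !mxE /powR gt_eqF // mulrC.
Qed.

Lemma dil_expR t x : dil G (expR t) x = flow t x.
Proof. by rewrite dil_flow ?expR_gt0 // expRK. Qed.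

Lemma flowE t x : flow t x =
  (\row_i ((x *m invmx (hg_P G)) 0 i * expR (t * hg_nu G i))) *m hg_P G.
Proof.
rewrite /flow !mulmxA; congr (_ *m _); apply/rowP => i.
by rewrite mul_mx_diag !mxE.
Qed.

Lemma flow0 x : flow 0 x = x.
Proof.
rewrite flowE (_ : \row__ _ = x *m invmx (hg_P G)) ?mulmxKV //.
by apply/rowP => i; rewrite mxE mul0r expR0 mulr1.
Qed.

Lemma flowD s t x : flow (s + t) x = flow s (flow t x).
Proof.
rewrite !flowE mulmxK //; congr (_ *m _); apply/rowP => i.
by rewrite !mxE -mulrA -expRD -mulrDl addrC.
Qed.

Lemma hdimE : hdim G = \sum_i hg_nu G i.
Proof.
rewrite /hdim /hg_A mxtrace_mulC mulmxA mulmxV // mul1mx mxtrace_diag.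
by apply: eq_bigr => i _; rewrite mxE.
Qed.

Lemma rV_int_flow t g : Cc g ->
  rV_int (fun x => g (flow t x)) = expR (- (t * hdim G)) * rV_int g.
Proof.
move=> gC; have uV : invmx (hg_P G) \in unitmx by rewrite unitmx_inv.
have [c hc] := rV_int_mulmx uV.
pose g1 x := g (x *m hg_P G).
have g1C : Cc g1 by exact: Cc_mulmx.
have e0 i : 0 < expR (t * hg_nu G i) by exact: expR_gt0.
have sC : Cc (fun x : 'rV[R]_n => g1 (\row_i (x 0 i * expR (t * hg_nu G i)))).
  have := @Cc_mulmx _ _ (diag_mx (\row_i expR (t * hg_nu G i))) g1.
  have -> : (fun x => g1 (x *m diag_mx (\row_i expR (t * hg_nu G i)))) =
    (fun x : 'rV[R]_n => g1 (\row_i (x 0 i * expR (t * hg_nu G i)))).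
    apply/funext => x; congr g1; apply/rowP => i; by rewrite mul_mx_diag !mxE.
  apply => //; rewrite unitmxE det_diag unitfE.
  by apply/prodf_neq0 => i _; rewrite mxE gt_eqF.
transitivity (rV_int (fun x =>
   (fun z : 'rV[R]_n => g1 (\row_i (z 0 i * expR (t * hg_nu G i)))) (x *m invmx (hg_P G)))).
  by congr rV_int; apply/funext => x; rewrite flowE.
(* The unknown factor [c] enters on passing to eigencoordinates and leaves on the way back, so only
   the product of the eigenvalues [expR (t * hg_nu G i)] survives. *)
rewrite (hc _ sC) rV_int_scale // mulrCA -hc //.
have -> : (fun x => g1 (x *m invmx (hg_P G))) = g.
  by apply/funext => x; rewrite /g1 mulmxKV.
by rewrite hdimE mulr_sumr expRN expR_sum.
Qed.

End Flow.

(** * Differentiation along curves *)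

Section Caratheodory.
Context {R : realType}.

(** Caratheodory's criterion: differentiability at [t0] is a factorisation of the increment through
    a slope function continuous at [t0]. *)
Lemma is_derive_factor (f phi : R -> R) (t0 : R) :
  (forall t, f t - f t0 = (t - t0) * phi t) -> {for t0, continuous phi} ->
  is_derive t0 1 f (phi t0).
Proof.
move=> fphi cphi.
have cv : h^-1 *: ((f \o shift t0) (h *: 1) - f t0) @[h --> 0^'] --> phi t0.
  apply: (@cvg_trans _ (phi (h + t0) @[h --> 0^'])).
    apply: near_eq_cvg; near=> h.
    have h0 : h != 0 by near: h; exact: nbhs_dnbhs_neq.
    rewrite /= fphi addrK /GRing.scale /= mulr1 mulrA mulVf // mul1r //.
  have c0 : h + t0 @[h --> (0 : R)] --> t0.
    have : h + t0 @[h --> (0 : R)] --> 0 + t0.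
      by apply: cvgD; [exact: cvg_id|exact: cvg_cst].
    by rewrite add0r.
  have c1 : phi (h + t0) @[h --> (0 : R)] --> phi t0.
    exact: (@cvg_comp _ _ _ (fun h => h + t0) phi _ _ _ c0 cphi).
  by move=> A /c1; exact: nbhs_dnbhs.
apply: DeriveDef; first by apply/cvg_ex; exists (phi t0).
exact: cvg_lim.
Unshelve. all: by end_near. Qed.

Lemma is_derive_factorE (f : R -> R) (t0 l : R) : is_derive t0 1 f l ->
  exists phi : R -> R, [/\ forall t, f t - f t0 = (t - t0) * phi t,
    {for t0, continuous phi} & phi t0 = l].
Proof.
move=> fl; exists (fun t => if t == t0 then l else (f t - f t0) / (t - t0)); split.
- move=> t; case: eqP => [->|/eqP tt]; first by rewrite !subrr mul0r.
  by rewrite mulrC divfK // subr_eq0.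
- have cv : h^-1 *: ((f \o shift t0) (h *: 1) - f t0) @[h --> 0^'] --> l.
    by case: fl => dv <-.
  apply/cvgrPdist_lt => e e0; rewrite eqxx.
  move/cvgrPdist_lt : cv => /(_ _ e0) /nbhs_ballP[d /= d0 hd].
  apply/nbhs_ballP; exists d => //= t td.
  case: eqP => [_|/eqP tt]; first by rewrite subrr normr0.
  have := hd (t - t0); rewrite /ball /= sub0r normrN subr_eq0 => /(_ _ tt).
  rewrite distrC => /(_ td).
  by rewrite /GRing.scale /= mulr1 subrK mulrC.
- by rewrite eqxx.
Qed.

Lemma is_derive_mul (f g : R -> R) (t a b : R) : is_derive t 1 f a ->
  is_derive t 1 g b -> is_derive t 1 (fun s => f s * g s) (f t * b + g t * a).
Proof. exact: is_deriveM. Qed.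

Lemma is_derive_add (f g : R -> R) (t a b : R) : is_derive t 1 f a ->
  is_derive t 1 g b -> is_derive t 1 (fun s => f s + g s) (a + b).
Proof. exact: is_deriveD. Qed.

Lemma is_derive_compose (f g : R -> R) (t a b : R) : is_derive (g t) 1 f a ->
  is_derive t 1 g b -> is_derive t 1 (fun s => f (g s)) (a * b).
Proof. exact: is_derive1_comp. Qed.

Lemma is_derive_mulr (t c : R) : is_derive t 1 (fun s => s * c) c.
Proof.
apply: (@is_derive_factor _ (fun=> c)); last exact: cvg_cst.
by move=> s; rewrite mulrBl.
Qed.

Lemma is_derive_continuous (f : R -> R) (t0 l : R) : is_derive t0 1 f l ->
  {for t0, continuous f}.
Proof.
move=> fl; apply: differentiable_continuous; apply/derivable1_diffP.
exact: ex_derive.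
Qed.

Lemma MVT_between (f df : R -> R) (a b : R) : (forall x : R, is_derive x 1 f (df x)) ->
  exists c : R, `|c - a| <= `|b - a| /\ f b - f a = df c * (b - a).
Proof.
move=> fdf.
have cf (A : set R) : {within A, continuous f}.
  by apply: continuous_within => x; exact: (is_derive_continuous (fdf x)).
have [ab|ba] := leP a b.
  have [c + ->] := @MVT_segment _ f df a b ab (fun x _ => fdf x) (cf _).
  rewrite in_itv /= => /andP[h1 h2]; exists c; split => //.
  by rewrite !ger0_norm; lra.
have [c + h] := @MVT_segment _ f df b a (ltW ba) (fun x _ => fdf x) (cf _).
rewrite in_itv /= => /andP[h1 h2]; exists c; split; last by lra.
by rewrite !ler0_norm; lra.
Qed.

End Caratheodory.

(** * The chain rule from continuous directional derivatives *)

Section ChainRule.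
Context {R : realType} (n : nat).
Implicit Types (u : 'rV[R]_n -> R) (v w y : 'rV[R]_n).

Lemma is_derive_line u v y (s : R) : (forall x, derivable u x v) ->
  is_derive s 1 (fun s => u (y + s *: v)) ('D_v u (y + s *: v)).
Proof.
move=> du.
have E : (fun h : R => h^-1 *: (((fun s => u (y + s *: v)) \o shift s) (h *: 1) - u (y + s *: v))) =
    (fun h => h^-1 *: ((u \o shift (y + s *: v)) (h *: v) - u (y + s *: v))).
  apply/funext => h /=; congr (_ *: (u _ - _)).
  have -> : h%:A = h :> R by rewrite /GRing.scale /= mulr1.
  by rewrite scalerDl addrCA.
apply: DeriveDef; last by rewrite /derive E.
by rewrite /derivable E; exact: du.
Qed.

(** By the mean value theorem the quotient is a value of ['D_v u] at a nearby point, so continuity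
    of ['D_v u] gives continuity jointly in the step and the base point. Joint continuity matters
    because the base point will move too. *)
Lemma continuous_slope u v (a0 : R) w0 :
  (forall x, derivable u x v) -> continuous ('D_v u) ->
  {for (a0, w0), continuous (fun z : R * 'rV[R]_n =>
     if z.1 == a0 then 'D_v u (z.2 + a0 *: v)
     else (u (z.2 + z.1 *: v) - u (z.2 + a0 *: v)) / (z.1 - a0))}.
Proof.
move=> du cD; apply/cvgrPdist_lt => e e0 /=; rewrite eqxx.
have /cvgrPdist_lt/(_ _ e0) /nbhs_ballP[d /= d0 hd] := cD (w0 + a0 *: v).
have hd' y : `|w0 + a0 *: v - y| < d -> `|'D_v u (w0 + a0 *: v) - 'D_v u y| < e.
  by move=> yd; apply: hd; rewrite -ball_normE.
(* Half of the radius [d] is spent on the base point, half on the displacement along [v]; the added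
   [1] covers [v = 0]. *)
pose d1 := d / 2 / (`|v| + 1).
have v1 : 0 < `|v| + 1 by rewrite ltr_wpDl.
have d10 : 0 < d1 by rewrite !divr_gt0.
near=> z.
have z1 : `|a0 - z.1| < d1.
  near: z; have /cvgrPdist_lt : (fst : R * 'rV[R]_n -> R) @ (a0, w0) --> a0 by exact: cvg_fst.
  exact.
have z2 : `|w0 - z.2| < d / 2.
  near: z; have /cvgrPdist_lt : (snd : R * 'rV[R]_n -> _) @ (a0, w0) --> w0 by exact: cvg_snd.
  by apply; rewrite divr_gt0.
have close (c : R) : `|c - a0| <= `|z.1 - a0| ->
    `|'D_v u (w0 + a0 *: v) - 'D_v u (z.2 + c *: v)| < e.
  move=> ca; apply: hd'.
  rewrite (_ : _ - _ = (w0 - z.2) + (a0 - c) *: v); last first.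
    by rewrite scalerBl opprD addrACA.
  apply: (le_lt_trans (ler_normD _ _)); rewrite normrZ (splitr d).
  apply: ltr_leD => //; rewrite distrC in ca; rewrite [`|z.1 - _|]distrC in ca.
  apply: (@le_trans _ _ (d1 * (`|v| + 1))); last by rewrite divfK // gt_eqF.
  apply: ler_pM => //; last by rewrite lerDl.
  by rewrite (le_trans ca) // ltW.
case: ifPn => [_|za].
  by apply: close; rewrite subrr normr0.
have [c [ca ->]] := @MVT_between R (fun s => u (z.2 + s *: v))
  (fun s => 'D_v u (z.2 + s *: v)) a0 z.1 (fun s => is_derive_line z.2 s du).
by rewrite mulfK ?subr_eq0 //; exact: close.
Unshelve. all: by end_near. Qed.

(** The increment is telescoped one direction at a time. [H] is the increment along [v i] over a
    base point that still moves with the remaining directions; in what is left [a i] is frozen at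
    [t0], so [a i t0 *: v i] joins the constant [c] in the induction hypothesis. *)
Lemma is_derive_directions (I : Type) u (v : I -> 'rV[R]_n) (a : I -> R -> R)
    (a' : I -> R) (t0 : R) (s : seq I) (c : 'rV[R]_n) :
  (forall i x, derivable u x (v i)) -> (forall i, continuous ('D_(v i) u)) ->
  (forall i, is_derive t0 1 (a i) (a' i)) ->
  is_derive t0 1 (fun t => u (c + \sum_(i <- s) a i t *: v i))
    (\sum_(i <- s) a' i * 'D_(v i) u (c + \sum_(j <- s) a j t0 *: v j)).
Proof.
move=> du cD da; elim: s c => [|i s IH] c.
  rewrite big_nil; under eq_fun do rewrite big_nil.
  exact: is_derive_cst.
rewrite big_cons.
pose S t := \sum_(j <- s) a j t *: v j.
have cS : {for t0, continuous S}.
  apply: cvg_big; first exact: add_continuous.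
  move=> j _; apply: cvgZr_tmp; exact: (is_derive_continuous (da j)).
have [phi [aphi cphi phi0]] := is_derive_factorE (da i).
pose D (z : R * 'rV[R]_n) :=
  if z.1 == a i t0 then 'D_(v i) u (z.2 + a i t0 *: v i)
  else (u (z.2 + z.1 *: v i) - u (z.2 + a i t0 *: v i)) / (z.1 - a i t0).
pose H t := u ((c + S t) + a i t *: v i) - u ((c + S t) + a i t0 *: v i).
have HD : is_derive t0 1 H (phi t0 * D (a i t0, c + S t0)).
  apply: (@is_derive_factor _ H (fun t => phi t * D (a i t, c + S t))).
    move=> t; rewrite mulrA -aphi /H /D /= subrr subr0.
    case: eqP => [->|/eqP ne]; first by rewrite !subrr mul0r.
    by rewrite mulrC divfK // subr_eq0.
  apply: cvgM; first exact: cphi.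
  have cS' : {for t0, continuous (fun t => c + S t)}.
    by apply: cvgD; [exact: cvg_cst|exact: cS].
  have cp := continuous_at_pair (is_derive_continuous (da i)) cS'.
  apply: (@continuous_comp _ _ _ (fun t => (a i t, c + S t)) D t0 cp).
  exact: continuous_slope.
have := is_deriveD HD (IH (c + a i t0 *: v i)).
rewrite /D /= eqxx phi0 => h.
have E : H + (fun t => u (c + a i t0 *: v i + S t)) =
    (fun t => u (c + \sum_(j <- i :: s) a j t *: v j)).
  apply/funext => t; rewrite big_cons /= -/(S t) fctE /H.
  by rewrite [c + S t + a i t0 *: _]addrAC subrK addrAC -addrA.
rewrite -E; apply: (is_derive_eq h); rewrite big_cons -/(S t0).
have -> : c + S t0 + a i t0 *: v i = c + (a i t0 *: v i + S t0).
  by rewrite addrAC addrA.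
by rewrite addrA.
Qed.

End ChainRule.

(** * The Euler operator *)

Section Euler.
Context {R : realType} (n : nat) (G : @hgroup R n).
Hypothesis Pu : hg_P G \in unitmx.
Implicit Types u g : 'rV[R]_n -> R.

Definition eigcoord (x : 'rV[R]_n) (i : 'I_n) : R := (x *m invmx (hg_P G)) 0 i.

(** The derivative along the linear vector field [x *m hg_A G], expanded in the basis formed by the
    rows of [hg_P G]. *)
Definition euler u (x : 'rV[R]_n) : R :=
  \sum_i (hg_nu G i * eigcoord x i) * 'D_(row i (hg_P G)) u x.

Lemma flow_sum t x : flow G t x =
  \sum_i (eigcoord x i * expR (t * hg_nu G i)) *: row i (hg_P G).
Proof.
by rewrite flowE mulmx_sum_row; apply: eq_bigr => i _; rewrite mxE.
Qed.

Lemma eigcoord_flow t x i :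
  eigcoord (flow G t x) i = eigcoord x i * expR (t * hg_nu G i).
Proof. by rewrite /eigcoord flowE mulmxK // mxE. Qed.

Lemma is_derive_flow u x (t : R) :
  (forall v x, derivable u x v) -> (forall v, continuous ('D_v u)) ->
  is_derive t 1 (fun t => u (flow G t x)) (euler u (flow G t x)).
Proof.
move=> du cD.
have da i : is_derive t 1 (fun t => eigcoord x i * expR (t * hg_nu G i))
    (hg_nu G i * eigcoord (flow G t x) i).
  rewrite eigcoord_flow.
  have d2 := is_derive_compose (is_derive_expR _) (is_derive_mulr t (hg_nu G i)).
  apply: (is_derive_eq (is_derive_mul (is_derive_cst (eigcoord x i) t 1) d2)).
  by rewrite /cst mulr0 addr0; ring.
have := @is_derive_directions R n 'I_n u (fun i => row i (hg_P G)) _ _ t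
  (index_enum 'I_n) 0 (fun i => du _) (fun i => cD _) da.
under eq_fun do rewrite add0r -flow_sum.
by move=> h; apply: (is_derive_eq h); apply: eq_bigr => i _; rewrite add0r -flow_sum.
Qed.

Lemma continuous_sum (T : topologicalType) (I : finType) (f : I -> T -> R) :
  (forall i, continuous (f i)) -> continuous (fun x => \sum_i f i x).
Proof.
move=> cf x; apply: cvg_big; first exact: add_continuous.
by move=> i _; exact: cf.
Qed.

Lemma continuous_eigcoord i : continuous (eigcoord^~ i).
Proof.
exact: (continuous_compose (@continuous_mulmxr R n n (invmx (hg_P G)))
  (@coord_continuous _ _ _ _ _)).
Qed.

Lemma continuous_euler u : (forall v, continuous ('D_v u)) -> continuous (euler u).
Proof.
move=> cD; apply: continuous_sum => i; apply: continuous_mul; last exact: cD.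
by apply: continuous_mul; [exact: cst_continuous|exact: continuous_eigcoord].
Qed.

Lemma euler_near0 u x : (\forall y \near x, u y = 0) -> euler u x = 0.
Proof.
move=> u0; rewrite /euler big1 // => i _.
by rewrite (@near_eq_derive _ _ _ u (cst 0)) // derive_cst mulr0.
Qed.

Lemma continuous_flow : continuous (fun z : R * 'rV[R]_n => flow G z.1 z.2).
Proof.
have -> : (fun z : R * 'rV[R]_n => flow G z.1 z.2) = (fun z =>
    (\row_i (eigcoord z.2 i * expR (z.1 * hg_nu G i))) *m hg_P G).
  by apply/funext => z; rewrite flowE.
suff c : continuous (fun z : R * 'rV[R]_n =>
    \row_i (eigcoord z.2 i * expR (z.1 * hg_nu G i))).
  exact: (continuous_compose c (@continuous_mulmxr R n n (hg_P G))).
apply: continuous_rV => i.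
have -> : (fun z : R * 'rV[R]_n =>
    (\row_i (eigcoord z.2 i * expR (z.1 * hg_nu G i))) 0 i) =
  (fun z => eigcoord z.2 i * expR (z.1 * hg_nu G i)).
  by apply/funext => z; rewrite mxE.
apply: continuous_mul.
  exact: (continuous_compose (@continuous_snd _ _) (@continuous_eigcoord i)).
suff c : continuous (fun z : R * 'rV[R]_n => z.1 * hg_nu G i).
  exact: (continuous_compose c (@continuous_expR R)).
by apply: continuous_mul; [exact: continuous_fst|exact: cst_continuous].
Qed.

Lemma flowK t x : flow G (- t) (flow G t x) = x.
Proof. by rewrite -flowD // addNr flow0. Qed.

(** For small times the backward flow enlarges a ball by at most [1]; this gives one ball containing
    the supports of all [g \o flow G t] with [t] near [0]. *)
Lemma flow_proper (M : R) :
  \forall t \near (0 : R), forall x, `|flow G t x| <= M -> `|x| <= M + 1.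
Proof.
have /compact_near_coveringP := @compact_balls_rV R n M.
move=> /(_ R (nbhs (0 : R)) (fun t y => `|flow G (- t) y| <= M + 1) _) H.
have {}H : \forall t \near (0 : R), forall y : 'rV[R]_n, `|y| <= M -> `|flow G (- t) y| <= M + 1.
  apply: H => y /= yM.
  have c : continuous (fun z : 'rV[R]_n * R => `|flow G (- z.2) z.1|).
    have c1 : continuous (fun z : 'rV[R]_n * R => (- z.2, z.1)).
      apply: continuous_pair; last exact: continuous_fst.
      apply: (continuous_compose (@continuous_snd _ _)) => t; exact: opp_continuous.
    have c2 := continuous_compose c1 continuous_flow.
    apply: (continuous_compose c2) => z; exact: norm_continuous.
  have /cvgrPdist_lt/(_ 1 ltr01) := c (y, 0).
  apply: filterS => -[y' t] /=; rewrite oppr0 flow0 // => h.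
  have := ler_norm (`|flow G (- t) y'| - `|y|); rewrite distrC => h'.
  by lra.
by near=> t => x xM; rewrite -(flowK t x); move: (flow G t x) xM; near: t.
Unshelve. all: by end_near. Qed.

Lemma Cc_flow t g : Cc g -> Cc (fun x => g (flow G t x)).
Proof.
move=> gC; rewrite /flow; apply: Cc_mulmx gC.
rewrite !unitmx_mul unitmx_inv Pu andbT /= unitmxE det_diag unitfE.
by apply/prodf_neq0 => i _; rewrite mxE gt_eqF // expR_gt0.
Qed.

(* Differentiate [rV_int (g \o flow t) = expR (- t * hdim G) * rV_int g] at [t = 0]. *)
Lemma rV_int_euler g (Eg : 'rV[R]_n -> R) : Cc g -> Cc Eg ->
  (forall (t : R) x, is_derive t 1 (fun t => g (flow G t x)) (Eg (flow G t x))) ->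
  rV_int Eg = - hdim G * rV_int g.
Proof.
move=> gC EC dg.
(* The difference quotient in time, completed at [t = 0] by its limit: differentiating the integral
   becomes continuity of [rV_int (H t)] at [0]. *)
pose H (t : R) x := if t == 0 then Eg x else t^-1 * (g (flow G t x) - g x).
have HC t : Cc (H t).
  rewrite /H; case: eqP => // _.
  by apply: CcZ; apply: CcB => //; exact: Cc_flow.
have [cg [M gM]] := gC; have [cE [N EN]] := EC.
(* The mean value theorem expresses the quotient through [Eg] at an intermediate time, so joint
   continuity of [H] at [t = 0] follows from that of [Eg] along the flow. *)
have HE t x : exists2 s : R, `|s| <= `|t| & H t x = Eg (flow G s x).
  rewrite /H; case: eqP => [->|/eqP t0].
    by exists 0; rewrite ?normr0 // flow0.
  have [s] := @MVT_between R (fun t => g (flow G t x)) (fun t => Eg (flow G t x))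
    0 t (fun t => dg t x).
  rewrite !subr0 flow0 // => -[st ->]; exists s => //.
  by rewrite mulrCA mulVf // mulr1.
pose PL := pos_functional_rV (R := R) n.
have cH : {for 0, continuous (fun t => rV_int (H t))}.
  (* The radius exceeds both [N], which bounds the support of [Eg], and the bound [|M| + 1] of
     [flow_proper] for the transported supports of [g]. *)
  apply: (@pos_functional_continuous _ _ _ _ H 0 (`|M| + 1 + `|N| + 1)).
  - exact: compact_balls_rV.
  - exact: PL.
  - exact: HC.
  - move=> x; apply/cvgrPdist_lt => e e0 /=.
    have cEf : continuous (fun z : R * 'rV[R]_n => Eg (flow G z.1 z.2)).
      exact: (continuous_compose continuous_flow cE).
    have /cvgrPdist_lt/(_ _ e0) := cEf (0, x).
    move=> -[[A B] /= [A0 Bx] AB].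
    have /nbhs_ballP[d /= d0 dA] := A0.
    exists (ball (0 : R) d, B); first by split => //=; exact: nbhsx_ballx.
    move=> [t y] [/= td By]; rewrite -/(H t y).
    have [s st ->] := HE t y; rewrite {1}/H eqxx.
    suff : (A `*` B) (s, y) by move/AB; rewrite /= flow0.
    split => //=; apply: dA.
    by rewrite /ball /= sub0r normrN (le_lt_trans st) // -normrN -sub0r.
  - have p1 := flow_proper `|M|.
    near=> t => x xM; rewrite /H; case: eqP => [_|_].
      by apply: EN; have := ler_norm N; have := normr_ge0 M; lra.
    have -> : g x = 0.
      by apply: gM; have := ler_norm M; have := normr_ge0 N; lra.
    have -> : g (flow G t x) = 0; last by rewrite subrr mulr0.
    apply: gM; rewrite ltNge; apply/negP => h.
    suff : `|x| <= `|M| + 1 by have := normr_ge0 N; lra.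
    have p : forall x, `|flow G t x| <= `|M| -> `|x| <= `|M| + 1 by near: t.
    by apply: p; rewrite (le_trans h) // ler_norm.
have psi : is_derive (0 : R) 1 (fun t => rV_int (fun x => g (flow G t x))) (rV_int (H 0)).
  apply: (@is_derive_factor _ _ (fun t => rV_int (H t))) => // t.
  rewrite subr0 -(pos_functionalB PL); [|exact: Cc_flow|exact: Cc_flow].
  have [->|t0] := eqVneq t 0.
    by rewrite mul0r (_ : (fun x => _) = (fun x => 0 * g x));
      [case: PL => _ -> //; rewrite mul0r|apply/funext => x; rewrite subrr mul0r].
  case: PL => _ LZ _; rewrite -LZ //; congr rV_int; apply/funext => x.
  by rewrite /H (negbTE t0) mulrA mulfV // mul1r flow0.
have psi2 : is_derive (0 : R) 1 (fun t => rV_int (fun x => g (flow G t x)))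
    (- hdim G * rV_int g).
  under eq_fun do rewrite rV_int_flow //.
  have d2 := is_derive_compose (is_derive_expR _) (is_derive_mulr (0 : R) (- hdim G)).
  under eq_fun do rewrite -mulrN.
  apply: (is_derive_eq (is_derive_mul d2 (is_derive_cst (rV_int g) (0 : R) 1))).
  by rewrite /cst mul0r expR0; ring.
case: psi psi2 => _ e1 [_]; rewrite e1.
by rewrite /H eqxx.
Unshelve. all: by end_near. Qed.

End Euler.

(** * Powers of the complex modulus *)

Section ModulusPower.
Context {R : realType}.
Implicit Types a b e p : R.

Lemma continuous_powR_gt0 e (x : R) : 0 < x -> {for x, continuous (fun y => y `^ e)}.
Proof. by move=> x0; exact: (is_derive_continuous (is_derive1_powR e x0)). Qed.

Lemma continuous_powR_norm e : 0 < e -> continuous (fun x : R => `|x| `^ e).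
Proof.
move=> e0 x; have [->|x0] := eqVneq x 0; last first.
  apply: (@continuous_comp _ _ _ (fun x : R => `|x|) (fun y => y `^ e)).
    exact: norm_continuous.
  by apply: continuous_powR_gt0; rewrite normr_gt0.
apply/cvgrPdist_lt => d d0; rewrite normr0 powR0 ?gt_eqF //.
apply/nbhs_ballP; exists (d `^ e^-1) => /=; first exact: powR_gt0.
move=> y; rewrite /ball /= !sub0r !normrN => yd.
rewrite ger0_norm ?powR_ge0 //.
have := gt0_ltr_powR e0 _ _ yd; rewrite -powRrM mulVf ?gt_eqF // powRr1 ?ltW //.
by apply; rewrite !nnegrE ?powR_ge0.
Qed.

Definition cabs a b : R := Num.sqrt (a ^+ 2 + b ^+ 2).

Lemma cabs_ge0 a b : 0 <= cabs a b. Proof. exact: sqrtr_ge0. Qed.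

Lemma cabsC a b : cabs a b = cabs b a.
Proof. by rewrite /cabs addrC. Qed.

Lemma cabs_sqr a b : cabs a b ^+ 2 = a ^+ 2 + b ^+ 2.
Proof. by rewrite sqr_sqrtr // addr_ge0 // sqr_ge0. Qed.

Lemma norm_le_cabs a b : `|a| <= cabs a b.
Proof. by rewrite -sqrtr_sqr ler_wsqrtr // lerDl sqr_ge0. Qed.

Lemma cabs00 : cabs 0 0 = 0.
Proof. by rewrite /cabs expr0n addr0 sqrtr0. Qed.

Lemma cabs_eq0 a b : cabs a b = 0 -> a = 0 /\ b = 0.
Proof.
move=> ab0; have := norm_le_cabs a b; have := norm_le_cabs b a.
by rewrite cabsC ab0 !normr_le0 => /eqP -> /eqP ->.
Qed.

Lemma continuous_at_cabs (T : topologicalType) (f g : T -> R) x :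
  {for x, continuous f} -> {for x, continuous g} ->
  {for x, continuous (fun x => cabs (f x) (g x))}.
Proof.
move=> cf cg; rewrite /cabs.
apply: (@continuous_comp _ _ _ (fun x => f x ^+ 2 + g x ^+ 2) Num.sqrt); last first.
  exact: sqrt_continuous.
have h : {for x, continuous (fun x => f x * f x + g x * g x)}.
  by apply: cvgD; exact: cvgM.
exact: h.
Qed.

Lemma continuous_at_cabs_powR (T : topologicalType) (f g : T -> R) e x : 0 < e ->
  {for x, continuous f} -> {for x, continuous g} ->
  {for x, continuous (fun x => cabs (f x) (g x) `^ e)}.
Proof.
move=> e0 cf cg.
have -> : (fun x => cabs (f x) (g x) `^ e) = (fun y => `|y| `^ e) \o (fun x => cabs (f x) (g x)).
  by apply/funext => y /=; rewrite ger0_norm ?cabs_ge0.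
apply: continuous_comp; first exact: continuous_at_cabs.
exact: continuous_powR_norm.
Qed.

(** The first component of the gradient of [cabs a b ^ p / p]; the second is [pgrad p b a]. At the
    origin the factor [a] forces the value [0], whatever the sign of [p - 2]. *)
Definition pgrad p a b : R := a * cabs a b `^ (p - 2).

Lemma cabs_powRB1 p a b : 1 < p -> cabs a b * cabs a b `^ (p - 2) = cabs a b `^ (p - 1).
Proof.
move=> p1; have [c0|c0] := eqVneq (cabs a b) 0.
  by rewrite c0 mul0r powR0 // gt_eqF // subr_gt0.
rewrite -[X in X * _]powRr1 ?cabs_ge0 // -powRD; last by rewrite c0 implybT.
by congr (_ `^ _); lra.
Qed.

Lemma pgrad_le p a b : 1 < p -> `|pgrad p a b| <= cabs a b `^ (p - 1).
Proof.
move=> p1; rewrite -cabs_powRB1 // /pgrad normrM (ger0_norm (powR_ge0 _ _)).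
by rewrite ler_wpM2r ?powR_ge0 // norm_le_cabs.
Qed.

(** Where [f] and [g] vanish together the exponent [p - 2] may be negative; there continuity comes
    from [pgrad_le], whose exponent [p - 1] is positive. *)
Lemma continuous_pgrad (T : topologicalType) (f g : T -> R) p : 1 < p ->
  continuous f -> continuous g -> continuous (fun x => pgrad p (f x) (g x)).
Proof.
move=> p1 cf cg x; have [c0|c0] := eqVneq (cabs (f x) (g x)) 0; last first.
  apply: cvgM; first exact: cf.
  apply: (@continuous_comp _ _ _ (fun x => cabs (f x) (g x)) (fun y => y `^ (p - 2))).
    by apply: continuous_at_cabs; [exact: cf|exact: cg].
  by apply: continuous_powR_gt0; rewrite lt_neqAle eq_sym c0 cabs_ge0.
have [f0 g0] := cabs_eq0 c0.
have p10 : 0 < p - 1 by rewrite subr_gt0.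
apply/cvgrPdist_lt => e e0.
have /cvgrPdist_lt/(_ _ e0) := continuous_at_cabs_powR p10 (cf x) (cg x).
apply: filterS => y; rewrite f0 g0 cabs00 powR0 ?gt_eqF // /pgrad mul0r !sub0r !normrN.
rewrite (ger0_norm (powR_ge0 _ _)); exact: le_lt_trans (pgrad_le _ _ p1).
Qed.

Lemma is_derive_cabs_powR p (A B : R -> R) (t a b : R) : 1 < p ->
  is_derive t 1 A a -> is_derive t 1 B b ->
  is_derive t 1 (fun s => cabs (A s) (B s) `^ p)
    (p * (pgrad p (A t) (B t) * a + pgrad p (B t) (A t) * b)).
Proof.
move=> p1 dA dB; have p0 : 0 < p by lra.
have [c0|c0] := eqVneq (cabs (A t) (B t)) 0.
  have [A0 B0] := cabs_eq0 c0.
  have [phi [Aphi cphi phi0]] := is_derive_factorE dA.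
  have [psi [Bpsi cpsi psi0]] := is_derive_factorE dB.
  (* At a zero the modulus is [|s - t|] times the modulus of the slopes. One factor of the [p]-th
     power supplies [s - t] up to sign, and the remaining power [p - 1 > 0] makes the slope function
     tend to [0]. *)
  pose th s := Num.sg (s - t) * cabs (phi s) (psi s) * cabs (A s) (B s) `^ (p - 1).
  have th0 : th t = 0 by rewrite /th subrr sgr0 !mul0r.
  have -> : p * (pgrad p (A t) (B t) * a + pgrad p (B t) (A t) * b) = th t.
    by rewrite th0 A0 B0 /pgrad !mul0r addr0 mulr0.
  apply: is_derive_factor => [s|].
    have cE : cabs (A s) (B s) = `|s - t| * cabs (phi s) (psi s).
      have -> : A s = (s - t) * phi s by rewrite -Aphi A0 subr0.
      have -> : B s = (s - t) * psi s by rewrite -Bpsi B0 subr0.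
      by rewrite /cabs !exprMn -mulrDr sqrtrM ?sqr_ge0 // sqrtr_sqr.
    rewrite c0 powR0 ?gt_eqF // subr0 /th.
    have -> : cabs (A s) (B s) `^ p = cabs (A s) (B s) * cabs (A s) (B s) `^ (p - 1).
      rewrite -[X in X * _]powRr1 ?cabs_ge0 // -powRD; last by rewrite addrC subrK gt_eqF.
      by rewrite addrC subrK.
    by rewrite {1}cE !mulrA [`|s - t|]normrEsg [Num.sg _ * _]mulrC.
  have p10 : 0 < p - 1 by rewrite subr_gt0.
  have cA := is_derive_continuous dA; have cB := is_derive_continuous dB.
  have cK : {for t, continuous (fun s =>
      cabs (phi s) (psi s) * cabs (A s) (B s) `^ (p - 1))}.
    apply: cvgM; first exact: continuous_at_cabs.
    exact: continuous_at_cabs_powR.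
  apply/cvgrPdist_lt => e e0; rewrite th0.
  have /cvgrPdist_lt/(_ _ e0) := cK; apply: filterS => s.
  rewrite c0 powR0 ?gt_eqF // mulr0 !sub0r !normrN; apply: le_lt_trans.
  rewrite /th -mulrA normrM -[leRHS]mul1r ler_wpM2r // normr_sg.
  by case: (_ == _).
have s0 : 0 < A t ^+ 2 + B t ^+ 2.
  by rewrite -cabs_sqr exprn_gt0 // lt_neqAle eq_sym c0 cabs_ge0.
(* Away from zeros the modulus power is a real power of the positive sum of squares, so no
   derivative of the square root is taken. *)
have cpE (q : R) (x y : R) : cabs x y `^ q = (x * x + y * y) `^ (2^-1 * q).
  by rewrite /cabs -powR12_sqrt ?addr_ge0 ?sqr_ge0 // -powRrM !expr2.
rewrite /pgrad; under eq_fun do rewrite cpE.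
have dS := is_derive_add (is_derive_mul dA dA) (is_derive_mul dB dB).
have s1 : 0 < A t * A t + B t * B t by rewrite -!expr2.
apply: (is_derive_eq (@is_derive_compose R (fun y => y `^ (2^-1 * p))
  (fun s => A s * A s + B s * B s) t _ _ (is_derive1_powR (2^-1 * p) s1) dS)).
rewrite [cabs (B t) _]cabsC !cpE.
have -> : 2^-1 * p - 1 = 2^-1 * (p - 2) by lra.
by set Z := _ `^ _; field.
Qed.

End ModulusPower.

(** * The radial integration by parts *)

Section ComplexRemainder.
Context {R : realType}.

Lemma normcE (z : R[i]) : Normc.normc z = cabs (complex.Re z) (complex.Im z).
Proof. by case: z. Qed.

Lemma pgradZ (p c a b : R) : pgrad p (c * a) (c * b) = c * `|c| `^ (p - 2) * pgrad p a b.
Proof.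
have -> : pgrad p (c * a) (c * b) = c * a * (`|c| * cabs a b) `^ (p - 2).
  by rewrite /pgrad {1}/cabs !exprMn -mulrDr sqrtrM ?sqr_ge0 // sqrtr_sqr.
by rewrite powRM ?cabs_ge0 // /pgrad; ring.
Qed.

Lemma cabsZ (c a b : R) : cabs (c * a) (c * b) = `|c| * cabs a b.
Proof. by rewrite /cabs !exprMn -mulrDr sqrtrM ?sqr_ge0 // sqrtr_sqr. Qed.

(** With [h = eta - xi], the part of [eta] along [h] contributes [p |h|^p], which turns [- |h|^p]
    into [(p - 1) |h|^p]. For [h = 0] every term containing [h] vanishes, so the formula also covers
    the separate branch of [Cp]. *)
Lemma Cp_expand (p x1 x2 h1 h2 : R) : 1 < p ->
  Cp p (Complex x1 x2) (Complex x1 x2 + Complex h1 h2) =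
  cabs x1 x2 `^ p + (p - 1) * cabs h1 h2 `^ p +
  p * (pgrad p h1 h2 * x1 + pgrad p h2 h1 * x2).
Proof.
move=> p1; have p0 : p != 0 by rewrite gt_eqF //; lra.
rewrite /Cp; case: eqP => [/eqP|/eqP ne].
  rewrite -subr_eq0 opprD addrA subrr sub0r oppr_eq0 eq_complex /= => /andP[/eqP -> /eqP ->].
  by rewrite cabs00 powR0 // /pgrad !mul0r addr0 !mulr0 !addr0.
have h0 : cabs h1 h2 != 0.
  apply: contra_neq ne => /cabs_eq0[-> ->].
  by apply/eqP; rewrite eq_complex /= !addr0 !eqxx.
have -> : Complex x1 x2 - (Complex x1 x2 + Complex h1 h2) = - Complex h1 h2.
  by rewrite opprD addrA subrr sub0r.
rewrite !normcE /=.
have -> : cabs (- h1) (- h2) = cabs h1 h2 by rewrite /cabs !sqrrN.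
have sq : cabs h1 h2 `^ p = cabs h1 h2 `^ (p - 2) * (h1 ^+ 2 + h2 ^+ 2).
  rewrite -cabs_sqr -powR_mulrn ?cabs_ge0 // -powRD; last by rewrite h0 implybT.
  by rewrite subrK.
by rewrite /pgrad [cabs h2 h1]cabsC sq; ring.
Qed.

End ComplexRemainder.

Lemma continuous_at_near0 {R : realType} (T : topologicalType) (f : T -> R) (x : T) :
  (\forall y \near x, f y = 0) -> {for x, continuous f}.
Proof.
move=> f0; apply/cvgrPdist_lt => e e0.
have -> : f x = 0 by exact: nbhs_singleton f0.
by apply: filterS f0 => y ->; rewrite subrr normr0.
Qed.

Section RadialIdentity.
Context {R : realType} (n : nat) (G : @hgroup R n) (qn : 'rV[R]_n -> R).
Hypothesis Pu : hg_P G \in unitmx.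
Hypothesis Hq : is_quasi_norm G qn.
Variable f : 'rV[R]_n -> R[i].
Hypothesis Hf : C0inf_punct f.

Let u x := complex.Re (f x).
Let v x := complex.Im (f x).

Lemma qn_gt0 x : x != 0 -> 0 < qn x.
Proof.
case: Hq => _ q0 _ _ qz x0; rewrite lt_neqAle q0 andbT eq_sym.
by apply: contra_neq x0 => /qz.
Qed.

Lemma qn0 : qn 0 = 0.
Proof. by case: Hq => _ _ _ _ qz; apply/qz. Qed.

Lemma qn_flow t x : qn (flow G t x) = expR t * qn x.
Proof. by case: Hq => _ _ _ qh _; rewrite -dil_expR qh // expR_gt0. Qed.

(** The weight may be discontinuous at the origin only, and there the product vanishes on a
    neighbourhood. *)
Lemma Cc_weight s h : Cc h -> (\forall x \near (0 : 'rV[R]_n), h x = 0) ->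
  Cc (fun x => qn x `^ s * h x).
Proof.
move=> [ch [M hM]] h0; split; last by exists M => x /hM ->; rewrite mulr0.
move=> x; have [->|x0] := eqVneq x 0.
  apply: continuous_at_near0.
  by apply: filterS h0 => y ->; rewrite mulr0.
apply: (@continuousM _ _ (fun x => qn x `^ s) h x); last exact: ch.
apply: (@continuous_comp _ _ _ qn (fun y => y `^ s)).
  by case: Hq => + _ _ _ _; apply.
by apply: continuous_powR_gt0; exact: qn_gt0.
Qed.

Lemma Cc_support (K : set 'rV[R]_n) h : compact K -> ~ K 0 -> continuous h ->
  (forall x, ~ K x -> h x = 0) -> Cc h /\ \forall x \near (0 : 'rV[R]_n), h x = 0.
Proof.
move=> cK K0 ch hK; split.
  split => //.
  have [M [_ KM]] := compact_bounded cK.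
  exists (M + 1) => x xM; apply: hK => Kx.
  have := KM (M + 1); rewrite ltrDl ltr01 => /(_ isT x Kx) /=.
  by rewrite leNgt xM.
have oK : open (~` K).
  by apply: closed_openC; apply: compact_closed => //; exact: norm_hausdorff.
have : nbhs (0 : 'rV[R]_n) (~` K) by apply: open_nbhs_nbhs; split.
by apply: filterS => x; exact: hK.
Qed.

Lemma smooth_derivable (g : 'rV[R]_n -> R) : smooth g ->
  (forall w x, derivable g x w) /\ (forall w, continuous ('D_w g)).
Proof.
move=> sg; split=> [w x|w]; first by have [_] := sg [::]; exact.
by have [] := sg [:: w].
Qed.

(** Along the ray through [x] dilation by [r] is the flow at time [ln r], and the derivative of [ln]
    at [qn x] produces the factor [(qn x)^-1]. *)
Lemma is_derive_dil (g : 'rV[R]_n -> R) x : smooth g -> x != 0 ->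
  derive1 (fun r => g (dil G r (dil G (qn x)^-1 x))) (qn x) = euler G g x * (qn x)^-1.
Proof.
move=> /smooth_derivable[dg cg] x0; have q0 := qn_gt0 x0.
set y := dil G _ x.
have yE : flow G (ln (qn x)) y = x.
  rewrite /y dil_flow ?invr_gt0 // -flowD // lnV ?posrE // subrr flow0 //.
have := is_derive_compose (is_derive_flow Pu y (ln (qn x)) dg cg) (is_derive1_ln q0).
rewrite yE => d.
rewrite derive1E (@near_eq_derive _ _ _ _ (fun r => g (flow G (ln r) y))).
  by case: d.
near=> r; rewrite dil_flow //; near: r.
exact: lt_nbhsr.
Unshelve. all: by end_near. Qed.

Lemma radialE x : radial G qn f x =
  Complex (euler G u x * (qn x)^-1) (euler G v x * (qn x)^-1).
Proof.
(* At the origin both sides are [0]: the ray is a constant curve and [0^-1 = 0]. *)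
have [su [sv _]] := Hf; rewrite /radial; have [->|x0] := eqVneq x 0.
  rewrite qn0 invr0 !mulr0.
  have E (g : 'rV[R]_n -> R) : derive1 (fun r => g (dil G r (dil G 0 0))) 0 = 0.
    rewrite derive1E; have -> : (fun r => g (dil G r (dil G 0 0))) = cst (g 0).
      by apply/funext => r; rewrite /dil !mul0mx.
    exact: derive_cst.
  by rewrite (E u) (E v).
by rewrite (is_derive_dil su x0) (is_derive_dil sv x0).
Qed.

Lemma C0inf_support : exists K : set 'rV[R]_n, [/\ compact K, ~ K 0,
  forall x, ~ K x -> f x = 0 &
  forall x, ~ K x -> euler G u x = 0 /\ euler G v x = 0].
Proof.
have [_ [_ [K [cK K0 fK]]]] := Hf; exists K; split => // x Kx.
have oK : open (~` K).
  by apply: closed_openC; apply: compact_closed => //; exact: norm_hausdorff.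
have nK : nbhs x (~` K) by apply: open_nbhs_nbhs; split.
by split; apply: euler_near0; apply: filterS nK => y /fK; rewrite /u /v => ->.
Qed.

Lemma continuous_u : continuous u. Proof. by have [/(_ [::])[]] := Hf. Qed.
Lemma continuous_v : continuous v. Proof. by have [_ [/(_ [::])[]]] := Hf. Qed.

Lemma Cc_power s e : 0 < e -> Cc (fun x => qn x `^ s * cabs (u x) (v x) `^ e).
Proof.
move=> e0; have [K [cK K0 fK _]] := C0inf_support.
have [] := @Cc_support K (fun x => cabs (u x) (v x) `^ e) cK K0.
- move=> x; apply: continuous_at_cabs_powR => //; [exact: continuous_u|exact: continuous_v].
- by move=> x /fK; rewrite /u /v => -> /=; rewrite cabs00 powR0 // gt_eqF.
exact: Cc_weight.
Qed.

Lemma Cc_euler_power s e : 0 < e ->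
  Cc (fun x => qn x `^ s * cabs (euler G u x) (euler G v x) `^ e).
Proof.
move=> e0; have [K [cK K0 _ eK]] := C0inf_support.
have [su [sv _]] := Hf.
have [] := @Cc_support K (fun x => cabs (euler G u x) (euler G v x) `^ e) cK K0.
- move=> x; apply: continuous_at_cabs_powR => //; apply: continuous_euler.
    by have [] := smooth_derivable su.
  by have [] := smooth_derivable sv.
- by move=> x /eK[-> ->]; rewrite cabs00 powR0 // gt_eqF.
exact: Cc_weight.
Qed.

(** This is [|f|^(p-2) Re (f conj (E f))] in real components; [p] times it is the derivative of
    [|f|^p] along the flow. *)
Definition pairing (p : R) x : R :=
  pgrad p (u x) (v x) * euler G u x + pgrad p (v x) (u x) * euler G v x.

Lemma Cc_pairing s p : 1 < p -> Cc (fun x => qn x `^ s * pairing p x).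
Proof.
move=> p1; have [K [cK K0 fK _]] := C0inf_support.
have [su [sv _]] := Hf.
have cu := continuous_u; have cv := continuous_v.
have [] := @Cc_support K (pairing p) cK K0.
- apply: continuous_add; apply: continuous_mul.
  + exact: continuous_pgrad.
  + by apply: continuous_euler; have [] := smooth_derivable su.
  + exact: continuous_pgrad.
  + by apply: continuous_euler; have [] := smooth_derivable sv.
- by move=> x /fK; rewrite /pairing /u /v => -> /=; rewrite /pgrad !mul0r addr0.
exact: Cc_weight.
Qed.

Lemma rV_int_pairing p alpha : 1 < p ->
  p * rV_int (fun x => qn x `^ (- alpha) * pairing p x) =
  (alpha - hdim G) * rV_int (fun x => qn x `^ (- alpha) * cabs (u x) (v x) `^ p).
Proof.
move=> p1; have p0 : 0 < p by lra.
have [su [sv _]] := Hf.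
have [du cu] := smooth_derivable su; have [dv cv] := smooth_derivable sv.
pose g x := qn x `^ (- alpha) * cabs (u x) (v x) `^ p.
pose T x := qn x `^ (- alpha) * pairing p x.
have gC : Cc g by exact: Cc_power.
have TC : Cc T by exact: Cc_pairing.
have [LD LZ _] := pos_functional_rV (R := R) n.
have EC : Cc (fun x => p * T x + (- alpha) * g x) by apply: CcD; exact: CcZ.
have := @rV_int_euler R n G Pu g _ gC EC.
rewrite LD; [|exact: CcZ|exact: CcZ].
rewrite !LZ // => E; suff : p * rV_int T + - alpha * rV_int g = - hdim G * rV_int g.
  by rewrite -/g -/T; lra.
apply: E => t x.
have wE s : qn (flow G s x) `^ (- alpha) = expR (s * - alpha) * qn x `^ (- alpha).
  rewrite qn_flow powRM ?expR_ge0 //; last by case: Hq.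
  by congr (_ * _); rewrite /powR gt_eqF ?expR_gt0 // expRK mulrC.
have -> : (fun t => g (flow G t x)) = (fun t => (expR (t * - alpha) * qn x `^ (- alpha)) *
    cabs (u (flow G t x)) (v (flow G t x)) `^ p).
  by apply/funext => s; rewrite /g wE.
have d1 := is_derive_compose (is_derive_expR _) (is_derive_mulr t (- alpha)).
have d2 := is_derive_mul d1 (is_derive_cst (qn x `^ (- alpha)) t 1).
have d3 := is_derive_cabs_powR p1 (is_derive_flow Pu x t du cu) (is_derive_flow Pu x t dv cv).
apply: (is_derive_eq (is_derive_mul d2 d3)).
by rewrite /cst /T /g /pairing wE; ring.
Qed.

End RadialIdentity.

(** * Bump functions *)

Section Bump.
Context {R : realType}.

(** The flat function [exp (-1/t)] with all its factors [t^-k]: the derivative of [beta k] is again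
    a combination of members of the family. *)
Definition beta (k : nat) (t : R) : R :=
  if 0 < t then expR (- t^-1) * t^-1 ^+ k else 0.

Lemma beta_ge0 k t : 0 <= beta k t.
Proof.
rewrite /beta; case: ltP => // t0.
by rewrite mulr_ge0 ?expR_ge0 // exprn_ge0 // invr_ge0 ltW.
Qed.

(** Makes [beta k.+1] the slope function of [beta k] at the origin: boundedness of the slope yields
    continuity there, and its continuity yields the derivative. *)
Lemma beta_step k t : beta k t = t * beta k.+1 t.
Proof.
rewrite /beta; case: ltP => t0; last by rewrite mulr0.
by rewrite exprS mulrCA [t * (_ * _)]mulrA mulfV ?mul1r // gt_eqF.
Qed.

Lemma beta_bounded k : exists C : R, forall t, beta k t <= C.
Proof.
case: k => [|k].
  exists 1 => t; rewrite /beta; case: ltP => // t0.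
  by rewrite expr0 mulr1 -expR0 ler_expR oppr_le0 invr_ge0 ltW.
(* With [s = 1/t] and [m = k.+1], the bound is [exp s = (exp (s/m))^m >= (s/m)^m]. *)
exists (k.+1%:R ^+ k.+1) => t; rewrite /beta; case: ltP => t0; last by rewrite exprn_ge0.
set s := t^-1; have s0 : 0 < s by rewrite invr_gt0.
rewrite expRN mulrC ler_pdivrMr ?expR_gt0 //.
have -> : expR s = expR (s / k.+1%:R) ^+ k.+1.
  by rewrite -expRM_natl mulrC divfK // pnatr_eq0.
rewrite -exprMn; apply: lerXn2r; rewrite ?nnegrE ?ltW //.
  by rewrite mulr_gt0 ?expR_gt0 ?ltr0n.
have := expR_ge1Dx (s / k.+1%:R) => h.
rewrite mulrC -ltr_pdivrMr ?ltr0n //; apply: lt_le_trans h.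
by rewrite addrC ltrDl.
Qed.

Lemma continuous_beta0 k : {for (0 : R), continuous (beta k)}.
Proof.
have [C hC] := beta_bounded k.+1.
have C0 : 0 <= C by apply: le_trans (hC 0); exact: beta_ge0.
have b0 : beta k 0 = 0 by rewrite /beta ltxx.
apply/cvgrPdist_lt => e e0; rewrite b0.
apply/nbhs_ballP; exists (e / (C + 1)) => /=; first by rewrite divr_gt0 // ltr_wpDl.
move=> t; rewrite /ball /= !sub0r !normrN ltr_pdivlMr ?ltr_wpDl // => te.
rewrite (ger0_norm (beta_ge0 _ _)) beta_step; have := hC t; have := beta_ge0 k.+1 t.
have := ler_norm t; have := normr_ge0 t; nra.
Qed.

Lemma is_derive_pow k (f : R -> R) (t a : R) : is_derive t 1 f a ->
  is_derive t 1 (fun s => f s ^+ k) (k%:R * f t ^+ k.-1 * a).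
Proof.
move=> da; elim: k => [|k IH].
  by rewrite !mul0r; exact: is_derive_cst.
have -> : (fun s => f s ^+ k.+1) = (fun s => f s * f s ^+ k).
  by apply/funext => s; rewrite exprS.
apply: (is_derive_eq (is_derive_mul da IH)).
by case: k {IH} => [|k]; rewrite /= ?exprS -?natr1; ring.
Qed.

Lemma is_derive_beta k (t : R) :
  is_derive t 1 (beta k) (beta k.+2 t - k%:R * beta k.+1 t).
Proof.
have [t0|t0|->] := ltgtP t 0.
- apply: (@near_eq_is_derive _ _ _ (cst 0)).
    near=> s; rewrite /beta ltNge ltW //=; near: s; exact: lt_nbhsl.
  apply: is_derive_eq; rewrite /beta ltNge ltW //=; lra.
- apply: (@near_eq_is_derive _ _ _ (fun t : R => expR (- t^-1) * t^-1 ^+ k)).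
    near=> s; rewrite /beta ifT //; near: s; exact: lt_nbhsr.
  have dV : is_derive t 1 (fun s : R => s^-1) (- t ^- 2).
    have tn0 : (id t : R) != 0 by rewrite gt_eqF.
    apply: (is_derive_eq (is_deriveV tn0 (is_derive_id t 1))).
    by rewrite /GRing.scale /= mulr1.
  have dN : is_derive t 1 (fun s : R => - s^-1) (- - t ^- 2) by exact: is_deriveN.
  have dE := is_derive_compose (is_derive_expR _) dN.
  have dX : is_derive t 1 (fun s : R => s^-1 ^+ k) (k%:R * t^-1 ^+ k.-1 * - t ^- 2).
    exact: (is_derive_pow k dV).
  apply: (is_derive_eq (is_derive_mul dE dX)); rewrite /beta t0 -exprVn.
  by case: k {dX} => [|k]; rewrite /= ?exprS; ring.
- have b0 j : beta j 0 = 0 by rewrite /beta ltxx.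
  have := @is_derive_factor R (beta k) (beta k.+1) 0 _ (@continuous_beta0 k.+1).
  rewrite !b0 mulr0 subr0; apply => s.
  by rewrite !subr0 -beta_step.
Unshelve. all: by end_near. Qed.

Variable n : nat.

Inductive elementary : ('rV[R]_n -> R) -> Prop :=
| elementary_cst c : elementary (fun=> c)
| elementary_coord i : elementary (fun x => x 0 i)
| elementary_add g h : elementary g -> elementary h -> elementary (fun x => g x + h x)
| elementary_mul g h : elementary g -> elementary h -> elementary (fun x => g x * h x)
| elementary_beta k g : elementary g -> elementary (fun x => beta k (g x)).

Lemma is_derive_lineP (g : 'rV[R]_n -> R) x w d :
  is_derive x w g d <-> is_derive (0 : R) 1 (fun s => g (x + s *: w)) d.
Proof.
have E : (fun h : R => h^-1 *: ((g \o shift x) (h *: w) - g x)) =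
    (fun h => h^-1 *: (((fun s => g (x + s *: w)) \o shift 0) (h *: 1) - g (x + 0 *: w))).
  apply/funext => h /=; rewrite scale0r !addr0; congr (_ *: (g _ - _)).
  have -> : h%:A = h :> R by rewrite /GRing.scale /= mulr1.
  exact: addrC.
by split => -[]; rewrite /derivable /derive => c l; apply: DeriveDef;
  rewrite /derivable /derive ?E // -E.
Qed.

Lemma elementary_derive (g : 'rV[R]_n -> R) : elementary g ->
  continuous g /\ forall w, exists2 dg, elementary dg & forall x, is_derive x w g (dg x).
Proof.
elim=> {g} [c|i|g h _ [cg dg] _ [ch dh]|g h eg [cg dg] eh [ch dh]|k g eg [cg dg]].
- split; first exact: cst_continuous.
  move=> w; exists (fun=> 0); first exact: elementary_cst.
  by move=> x; exact: is_derive_cst.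
- split; first exact: coord_continuous.
  move=> w; exists (fun=> w 0 i); first exact: elementary_cst.
  move=> x; apply/is_derive_lineP.
  apply: (@is_derive_factor _ _ (fun=> w 0 i)); last exact: cvg_cst.
  by move=> t; rewrite !mxE; ring.
- split; first exact: continuous_add.
  move=> w; have [g' eg' gg'] := dg w; have [h' eh' hh'] := dh w.
  exists (fun x => g' x + h' x); first exact: elementary_add.
  move=> x; have /is_derive_lineP d1 := gg' x; have /is_derive_lineP d2 := hh' x.
  by apply/is_derive_lineP; exact: is_derive_add.
- split; first exact: continuous_mul.
  move=> w; have [g' eg' gg'] := dg w; have [h' eh' hh'] := dh w.
  exists (fun x => g x * h' x + h x * g' x).
    by apply: elementary_add; exact: elementary_mul.
  move=> x; have /is_derive_lineP d1 := gg' x; have /is_derive_lineP d2 := hh' x.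
  apply/is_derive_lineP; apply: (is_derive_eq (is_derive_mul d1 d2)).
  by rewrite scale0r addr0.
- split.
    apply: (continuous_compose cg) => t; exact: (is_derive_continuous (is_derive_beta k t)).
  move=> w; have [g' eg' gg'] := dg w.
  exists (fun x => (beta k.+2 (g x) + - k%:R * beta k.+1 (g x)) * g' x).
    apply: elementary_mul => //; apply: elementary_add; first exact: elementary_beta.
    by apply: elementary_mul; [exact: elementary_cst|exact: elementary_beta].
  move=> x; have /is_derive_lineP d1 := gg' x; apply/is_derive_lineP.
  apply: (is_derive_eq (is_derive_compose (is_derive_beta k _) d1)).
  by rewrite scale0r addr0 mulNr.
Qed.

Lemma elementary_smooth (g : 'rV[R]_n -> R) : elementary g -> smooth g.
Proof.
move=> eg vs; have : elementary (iter_dd vs g).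
  elim: vs => [|w vs /elementary_derive[_ /(_ w)[dg edg dgE]]] //=.
  suff -> : (fun x => 'D_w (iter_dd vs g) x) = dg by [].
  by apply/funext => x; case: (dgE x).
move=> /elementary_derive[c d]; split => // w x; have [dg _ dgE] := d w.
by case: (dgE x).
Qed.

Lemma elementary_sum (I : Type) (s : seq I) (F : I -> 'rV[R]_n -> R) :
  (forall i, elementary (F i)) -> elementary (fun x => \sum_(i <- s) F i x).
Proof.
move=> eF; elim: s => [|i s IH].
  have -> : (fun x => \sum_(i <- [::]) F i x) = (fun=> 0) by apply/funext => x; rewrite big_nil.
  exact: elementary_cst.
have -> : (fun x => \sum_(j <- i :: s) F j x) = (fun x => F i x + \sum_(j <- s) F j x).
  by apply/funext => x; rewrite big_cons.
exact: elementary_add.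
Qed.

Lemma bump_exists : (0 < n)%N -> exists f : 'rV[R]_n -> R[i],
  C0inf_punct f /\ exists x, f x != 0.
Proof.
move=> n0.
(* [q] is positive exactly on the Euclidean ball of radius [1/2] about [(1, ..., 1)]. It lies in the
   cube with sides [[1/2, 2]], which misses the origin as [n] is positive. *)
pose q (x : 'rV[R]_n) : R := 4^-1 + - 1 * \sum_i (x 0 i + - 1) * (x 0 i + - 1).
have eq : elementary q.
  apply: elementary_add; first exact: elementary_cst.
  apply: elementary_mul; first exact: elementary_cst.
  apply: elementary_sum => i; apply: elementary_mul; apply: elementary_add;
    by [exact: elementary_coord|exact: elementary_cst].
exists (fun x => Complex (beta 0 (q x)) 0); split; last first.
  exists (const_mx 1); rewrite eq_complex /= negb_and; apply/orP; left.
  rewrite /q big1; last by move=> i _; rewrite !mxE subrr mul0r.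
  by rewrite mulr0 addr0 /beta invr_gt0 ltr0n expr0 mulr1 gt_eqF // expR_gt0.
split; first by apply: elementary_smooth; exact: elementary_beta.
split; first by apply: elementary_smooth; exact: elementary_cst.
exists [set x : 'rV[R]_n | forall i, `[2^-1, 2]%classic (x ord0 i)]; split.
- by apply: (@rV_compact R n (fun=> `[2^-1, 2]%classic)) => i; exact: segment_compact.
- move=> /(_ (Ordinal n0)); rewrite /= in_itv /= mxE => /andP[]; lra.
move=> x xK; suff : ~ 0 < q x by rewrite /beta => /negP/negbTE ->.
move=> qx; apply: xK => i.
have : (x 0 i + - 1) * (x 0 i + - 1) <= \sum_i (x 0 i + - 1) * (x 0 i + - 1).
  by rewrite (bigD1 i) //= lerDl; apply: sumr_ge0 => j _; rewrite -expr2 sqr_ge0.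
move: qx; rewrite /q /= in_itv /= => qx h; apply/andP; split; nra.
Qed.

End Bump.

(** * Interpolation and the value of the bracket *)

Section Interpolation.
Context {R : realType}.

(** The exponential lies above its tangent at the weighted mean [m] of [ln X] and [ln Y]; averaging
    the two tangent bounds cancels their linear terms. *)
Lemma weighted_amgm (X Y th : R) : 0 < X -> 0 < Y -> 0 <= th <= 1 ->
  X `^ th * Y `^ (1 - th) <= th * X + (1 - th) * Y.
Proof.
move=> X0 Y0 /andP[th0 th1].
pose m := th * ln X + (1 - th) * ln Y.
have -> : X `^ th * Y `^ (1 - th) = expR m.
  by rewrite /powR !gt_eqF // -expRD.
have em : 0 < expR m by exact: expR_gt0.
have bnd (Z : R) : 0 < Z -> expR m * (1 + (ln Z - m)) <= Z.
  move=> Z0; have e : Z = expR m * expR (ln Z - m).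
    by rewrite -expRD addrC subrK lnK.
  by rewrite [leRHS]e ler_pM2l // expR_ge1Dx.
have h1 := ler_wpM2l th0 (bnd X X0).
have th1' : 0 <= 1 - th by lra.
have h2 := ler_wpM2l th1' (bnd Y Y0).
apply: le_trans (lerD h1 h2).
have -> : th * (expR m * (1 + (ln X - m))) + (1 - th) * (expR m * (1 + (ln Y - m))) =
   expR m * (1 + (th * ln X + (1 - th) * ln Y - m)) by ring.
by rewrite -/m subrr addr0 mulr1.
Qed.

(** The weighted mean inequality is applied pointwise to [U / A] and [V / B] and integrated. The
    alternative [F x <= 0] covers the points where the factors vanish and keeps logarithms at
    positive arguments. *)
Lemma rV_int_hoelder n (U V F : 'rV[R]_n -> R) (th : R) x0 :
  Cc U -> Cc V -> Cc F -> 0 <= th <= 1 ->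
  (forall x, 0 <= U x) -> (forall x, 0 <= V x) -> 0 < U x0 -> 0 < V x0 ->
  (forall x, F x <= 0 \/ [/\ 0 < U x, 0 < V x & F x = U x `^ th * V x `^ (1 - th)]) ->
  rV_int F <= rV_int U `^ th * rV_int V `^ (1 - th).
Proof.
move=> UC VC FC th01 U0 V0 Ux Vx FE; have /andP[th0 th1] := th01.
set A := rV_int U; set B := rV_int V.
have A0 : 0 < A by exact: (rV_int_gt0 (x0 := x0)).
have B0 : 0 < B by exact: (rV_int_gt0 (x0 := x0)).
pose M := A `^ th * B `^ (1 - th).
have M0 : 0 < M by rewrite mulr_gt0 // powR_gt0.
have PL := pos_functional_rV (R := R) n; have [LD LZ _] := PL.
have th1' : 0 <= 1 - th by rewrite subr_ge0.
have bnd x : F x <= (M * th / A) * U x + (M * (1 - th) / B) * V x.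
  have [F0|[Ux0 Vx0 ->]] := FE x.
    have M0' := ltW M0.
    have A0' : 0 <= A^-1 by rewrite invr_ge0 ltW.
    have B0' : 0 <= B^-1 by rewrite invr_ge0 ltW.
    have c1 : 0 <= M * th / A by rewrite mulr_ge0 // mulr_ge0.
    have c2 : 0 <= M * (1 - th) / B by rewrite mulr_ge0 // mulr_ge0.
    by apply: (le_trans F0); rewrite addr_ge0 // mulr_ge0.
  have h := weighted_amgm (divr_gt0 Ux0 A0) (divr_gt0 Vx0 B0) th01.
  have e (a b s : R) : 0 < a -> 0 < b -> b `^ s = a `^ s * (b / a) `^ s.
    by move=> a0 b0; rewrite -powRM ?divr_ge0 ?ltW // mulrC divfK ?gt_eqF.
  rewrite (e A (U x)) // (e B (V x)) // mulrACA -/M.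
  apply: (le_trans (ler_wpM2l (ltW M0) h)).
  by rewrite le_eqVlt; apply/orP; left; apply/eqP; ring.
have := pos_functional_le PL FC (CcD (CcZ (M * th / A) UC) (CcZ (M * (1 - th) / B) VC)) bnd.
rewrite LD; [|exact: CcZ|exact: CcZ].
rewrite !LZ // -/A -/B !divfK ?gt_eqF // => h.
by apply: (le_trans h); rewrite -mulrDr addrC subrK mulr1.
Qed.

End Interpolation.

(** * The value of the bracket *)

Section MainIdentity.
Context {R : realType} (n : nat) (G : @hgroup R n) (qn : 'rV[R]_n -> R).
Hypothesis Pu : hg_P G \in unitmx.
Hypothesis Hq : is_quasi_norm G qn.
Variable f : 'rV[R]_n -> R[i].
Hypothesis Hf : C0inf_punct f.
Variables (p alpha : R).
Hypothesis p1 : 1 < p.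

Let u x := complex.Re (f x).
Let v x := complex.Im (f x).
Let om x := qn x `^ (- (alpha / p)).

Lemma xiE x : radial G qn f x * toC (qn x `^ (alpha / p - 1))^-1 =
  Complex (om x * euler G u x) (om x * euler G v x).
Proof.
rewrite (radialE Pu Hq Hf) /toC.
have [->|x0] := eqVneq x 0.
  rewrite (qn0 Hq) invr0 !mulr0.
  have [K [_ K0 _ /(_ 0 K0)[]]] := C0inf_support G Hf.
  rewrite /u /v => -> ->.
  by apply/eqP; rewrite eq_complex /= !(mulr0, mul0r, subr0, addr0) !eqxx.
have q0 := qn_gt0 Hq x0.
have omE : (qn x)^-1 * (qn x `^ (alpha / p - 1))^-1 = om x.
  rewrite -powRN -[X in X * _]powR_inv1 ?ltW // -powRD; last by rewrite (gt_eqF q0) implybT.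
  by congr (_ `^ _); lra.
apply/eqP; rewrite eq_complex /= !mulr0 subr0 add0r -omE.
by apply/andP; split; apply/eqP; rewrite /u /v; ring.
Qed.

Lemma etaE (k : R) x : toC k * f x * toC (qn x `^ (alpha / p))^-1 =
  Complex (k * om x * u x) (k * om x * v x).
Proof.
rewrite /om /u /v powRN /toC; case: (f x) => a b; set c := _^-1.
by apply/eqP; rewrite eq_complex /=; apply/andP; split; apply/eqP; ring.
Qed.

Lemma om_powR x : om x `^ p = qn x `^ (- alpha).
Proof.
by rewrite /om -powRrM mulNr divfK // gt_eqF // (lt_trans ltr01).
Qed.

(** Expanding [Cp] cancels the integral of [|xi|^p], and what remains carries the coefficient
    [- (p - 1) |k|^p] and a pairing term. By the radial integration by parts the pairing term equals
    [p |k|^p] times the same integral, and [p - (p - 1) = 1]. *)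
Lemma bracket_identity (k : R) : k = (hdim G - alpha) / p ->
  let xi x := radial G qn f x * toC (qn x `^ (alpha / p - 1))^-1 in
  let eta x := xi x + toC k * f x * toC (qn x `^ (alpha / p))^-1 in
  Lnorm_ p (fun x => Normc.normc (xi x)) `^ p -
    fine (leb_int (fun x => (Cp p (xi x) (eta x))%:E)) =
  `|k| `^ p * rV_int (fun x => qn x `^ (- alpha) * cabs (u x) (v x) `^ p).
Proof.
move=> kE xi eta; have p0 : 0 < p := lt_trans ltr01 p1.
have pn0 : p != 0 by rewrite gt_eqF.
pose X x := qn x `^ (- alpha) * cabs (euler G u x) (euler G v x) `^ p.
pose g x := qn x `^ (- alpha) * cabs (u x) (v x) `^ p.
pose T x := qn x `^ (- alpha) * pairing G f p x.
have XC : Cc X by exact: (Cc_euler_power Hq Hf).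
have gC : Cc g by exact: (Cc_power Hq Hf).
have TC : Cc T by exact: (Cc_pairing Hq Hf).
have om0 x : 0 <= om x by exact: powR_ge0.
have -> : Lnorm_ p (fun x => Normc.normc (xi x)) `^ p = rV_int X.
  rewrite /Lnorm_ -powRrM mulVf //.
  have -> : (fun x => (`|Normc.normc (xi x)| `^ p)%:E) = (fun x => (X x)%:E).
    apply/funext => x; rewrite /xi xiE normcE /= cabsZ !ger0_norm ?mulr_ge0 ?cabs_ge0 //.
    by rewrite powRM ?cabs_ge0 // om_powR.
  rewrite -/(rV_int X) powRr1 //.
  case: (pos_functional_rV (R := R) n) => _ _; apply => // x.
  by rewrite mulr_ge0 ?powR_ge0.
have CpE x : Cp p (xi x) (eta x) =
    X x + ((p - 1) * `|k| `^ p) * g x + (p * (k * `|k| `^ (p - 2))) * T x.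
  rewrite /eta /xi xiE etaE Cp_expand // !cabsZ !pgradZ !normrM !(ger0_norm (om0 x)).
  rewrite !powRM ?cabs_ge0 ?mulr_ge0 // om_powR /X /g /T /pairing.
  have [x0|x0] := eqVneq x 0.
    have [K [_ K0 /(_ 0 K0) f0 _]] := C0inf_support G Hf.
    by rewrite x0 /u /v f0 /= /pgrad; ring.
  have omp : om x != 0 by rewrite gt_eqF // powR_gt0 // (qn_gt0 Hq).
  (* In the mixed term one factor [om x] comes from [xi], and [om x * om x ^ (p - 2)] comes from the
     homogeneity of [pgrad]. *)
  have -> : qn x `^ (- alpha) = om x * (om x * om x `^ (p - 2)).
    rewrite -om_powR mulrA -expr2 -powR_mulrn // -powRD; last by rewrite omp implybT.
    by rewrite addrC subrK.
  by rewrite -/u -/v; ring.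
have -> : fine (leb_int (fun x => (Cp p (xi x) (eta x))%:E)) =
    rV_int X + ((p - 1) * `|k| `^ p) * rV_int g + (p * (k * `|k| `^ (p - 2))) * rV_int T.
  have [LD LZ _] := pos_functional_rV (R := R) n.
  rewrite -!LZ // -LD //; last exact: CcZ.
  rewrite -LD; [|apply: CcD => //; exact: CcZ|exact: CcZ].
  by rewrite /rV_int; congr (fine (leb_int _)); apply/funext => x; rewrite CpE.
have := rV_int_pairing Pu Hq Hf alpha p1; rewrite -/T -/g => TE.
have kk : k * (k * `|k| `^ (p - 2)) = `|k| `^ p.
  have [->|k0] := eqVneq k 0; first by rewrite mul0r normr0 powR0.
  rewrite mulrA -expr2 -real_normK ?num_real // -powR_mulrn // -powRD.
    by congr (_ `^ _); lra.
  by rewrite normr_eq0 k0 implybT.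
have pT : p * rV_int T = - (p * k) * rV_int g.
  by rewrite TE kE; congr (_ * _); field.
have -> : p * (k * `|k| `^ (p - 2)) * rV_int T = - (p * `|k| `^ p) * rV_int g.
  by rewrite -kk mulrAC pT; ring.
ring.
Qed.

End MainIdentity.

Local Close Scope classical_set_scope.

Theorem theorem5p3 (R : realType) (n : nat) (G : @hgroup R n)
  (qn : 'rV[R]_n -> R) (p q r delta alpha b c : R) :
  (0 < n)%N ->
  is_homogeneous_group G -> is_quasi_norm G qn ->
  1 < p -> 1 < q -> 0 < r -> r <= p + q ->
  0 <= delta <= 1 -> (r - q) / r <= delta <= p / r ->
  delta * r / p + (1 - delta) * r / q = 1 ->
  c = - delta + b * (1 - delta) ->
  let Q := hdim G in
  let w s := fun x : 'rV[R]_n => qn x `^ s in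
  let LHS (K : R) (f : 'rV[R]_n -> R[i]) :=
    K * Lnorm_ r (fun x => w (alpha * c / p) x * Normc.normc (f x)) in
  let RHS (f : 'rV[R]_n -> R[i]) :=
    let xi x := radial G qn f x * toC (w (alpha / p - 1) x)^-1 in
    let eta x := xi x + toC ((Q - alpha) / p) * f x * toC (w (alpha / p) x)^-1 in
    (Lnorm_ p (fun x => Normc.normc (xi x)) `^ p
       - fine (leb_int (fun x => (Cp p (xi x) (eta x))%:E))) `^ (delta / p)
    * Lnorm_ q (fun x => w (alpha * b / p) x * Normc.normc (f x)) `^ (1 - delta) in
  (forall f, C0inf_punct f -> LHS (`|(Q - alpha) / p| `^ delta) f <= RHS f)
  /\
  (alpha != Q ->
   ((q = p /\ b = -1) \/ delta = 0 \/ delta = 1) ->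
   forall K : R, `|(Q - alpha) / p| `^ delta < K ->
   exists f, C0inf_punct f /\ RHS f < LHS K f).
Proof.
move=> n0 [Pu _] Hq p1 q1 r0 _ d01 _ drpq cE Q w LHS RHS.
have p0 : 0 < p := lt_trans ltr01 p1; have q0 : 0 < q := lt_trans ltr01 q1.
have /andP[d0 d1] := d01.
pose k := (Q - alpha) / p.
pose F s e (f : 'rV[R]_n -> R[i]) (x : 'rV[R]_n) :=
  qn x `^ s * cabs (complex.Re (f x)) (complex.Im (f x)) `^ e.
have FC s e f : 0 < e -> C0inf_punct f -> Cc (F s e f).
  by move=> e0 Hf; exact: (Cc_power Hq Hf).
have F0 s e f x : 0 <= F s e f x by rewrite mulr_ge0 ?powR_ge0.
have int0 s e f : 0 < e -> C0inf_punct f -> 0 <= rV_int (F s e f).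
  move=> e0 Hf; case: (pos_functional_rV (R := R) n) => _ _; apply => //.
  exact: FC.
have Fgt0 s e f x : C0inf_punct f -> f x != 0 -> 0 < F s e f x.
  move=> Hf fx0; rewrite mulr_gt0 //; apply: powR_gt0.
    apply: (qn_gt0 Hq); apply: contra_neq fx0 => ->.
    have [_ [_ [K [_ K0 fK]]]] := Hf; exact: fK.
  rewrite lt_neqAle cabs_ge0 andbT eq_sym; apply: contra_neq fx0 => /cabs_eq0[].
  by case: (f x) => a a' /= -> ->.
have LE s e f : 0 < e -> Lnorm_ e (fun x => w s x * Normc.normc (f x)) =
    rV_int (F (s * e) e f) `^ e^-1.
  move=> e0; rewrite /Lnorm_ /rV_int; congr (fine (leb_int _) `^ _).
  apply/funext => x; rewrite /w normcE ger0_norm ?mulr_ge0 ?powR_ge0 ?cabs_ge0 //.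
  by rewrite powRM ?powR_ge0 ?cabs_ge0 // -powRrM.
have RE f : C0inf_punct f -> RHS f = `|k| `^ delta *
    (rV_int (F (- alpha) p f) `^ (delta / p) *
     rV_int (F (alpha * b / p * q) q f) `^ ((1 - delta) / q)).
  move=> Hf.
  transitivity ((`|k| `^ p * rV_int (F (- alpha) p f)) `^ (delta / p) *
    Lnorm_ q (fun x => w (alpha * b / p) x * Normc.normc (f x)) `^ (1 - delta)).
    congr (_ `^ _ * _).
    exact: (@bracket_identity R n G qn Pu Hq f Hf p alpha p1 k (erefl k)).
  rewrite LE // -powRrM [q^-1 * _]mulrC.
  rewrite powRM ?powR_ge0 //; last exact: int0.
  by rewrite -powRrM [p * _]mulrC divfK ?gt_eqF // mulrA.
(* The Hoelder weight. The relation between the exponents gives [1 - th = (1 - delta) r / q], so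
   [p th + q (1 - th) = r] matches the powers of [|f|], and the formula for [c] matches those of
   [|x|]. *)
pose th := delta * r / p.
have th1 : 1 - th = (1 - delta) * r / q by rewrite /th; lra.
have th01 : 0 <= th <= 1.
  have h1 : 0 <= th by rewrite !mulr_ge0 ?invr_ge0 // ltW.
  have h2 : 0 <= 1 - th by rewrite th1 !mulr_ge0 ?invr_ge0 ?subr_ge0 // ltW.
  by rewrite h1; lra.
split=> [f Hf|aQ cases K kK].
  (* Interpolation needs a point where the integrands are positive, so [f = 0] is treated apart. *)
  have [[x0 fx0]|nf] := pselect (exists x, f x != 0); last first.
    have -> : LHS (`|(Q - alpha) / p| `^ delta) f = 0; last first.
      by rewrite /RHS mulr_ge0 ?powR_ge0.
    rewrite /LHS LE //.
    have -> : rV_int (F (alpha * c / p * r) r f) = 0.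
      have [_ LZ _] := pos_functional_rV (R := R) n.
      have -> : F (alpha * c / p * r) r f = (fun x => 0 * F 0 r f x).
        apply/funext => x; rewrite mul0r /F.
        have -> : f x = 0 by apply/eqP/negPn/negP => fx; apply: nf; exists x.
        by rewrite /= cabs00 powR0 ?mulr0 // gt_eqF.
      by rewrite LZ ?mul0r //; exact: FC.
    by rewrite powR0 ?mulr0 // invr_neq0 // gt_eqF.
  rewrite RE // /LHS LE // -/k ler_wpM2l ?powR_ge0 //.
  have hoel : rV_int (F (alpha * c / p * r) r f) <=
      rV_int (F (- alpha) p f) `^ th * rV_int (F (alpha * b / p * q) q f) `^ (1 - th).
    apply: (rV_int_hoelder (x0 := x0)) => //; [exact: FC|exact: FC|exact: FC|
      exact: Fgt0|exact: Fgt0|].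
    move=> x; have [fx|fx] := eqVneq (f x) 0.
      by left; rewrite /F fx /= cabs00 powR0 ?mulr0 // gt_eqF.
    right; split; [exact: Fgt0|exact: Fgt0|].
    have xq : qn x != 0.
      rewrite gt_eqF // (qn_gt0 Hq) //; apply: contra_neq fx => ->.
      by have [_ [_ [K [_ K0 fK]]]] := Hf; exact: fK.
    have fc : cabs (complex.Re (f x)) (complex.Im (f x)) != 0.
      by apply: contra_neq fx => /cabs_eq0[]; case: (f x) => a a' /= -> ->.
    rewrite /F !powRM ?powR_ge0 // -!powRrM mulrACA -!powRD ?xq ?fc ?implybT //.
    by congr (_ `^ _ * _ `^ _); rewrite th1 /th ?cE; field; rewrite !gt_eqF.
  have := ge0_ler_powR _ _ _ hoel; move=> /(_ r^-1); rewrite invr_ge0 ltW // => /(_ isT).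
  rewrite !nnegrE int0 // mulr_ge0 ?powR_ge0 // => /(_ isT isT) h; apply: (le_trans h).
  rewrite powRM ?powR_ge0 // -!powRrM th1 /th.
  have -> : delta * r / p / r = delta / p by field; rewrite !gt_eqF.
  by have -> : (1 - delta) * r / q / r = (1 - delta) / q by field; rewrite !gt_eqF.
have [f [Hf [x0 fx0]]] := @bump_exists R n n0.
exists f; split => //; rewrite RE // /LHS LE //.
set N := rV_int (F (alpha * c / p * r) r f) `^ r^-1.
have N0 : 0 < N.
  by apply: powR_gt0; apply: (rV_int_gt0 (x0 := x0)); [exact: FC| |exact: Fgt0].
(* It remains to see equality in the interpolation; as [N > 0], comparing the two sides then amounts
   to comparing the constants. *)
suff -> : rV_int (F (- alpha) p f) `^ (delta / p) *
    rV_int (F (alpha * b / p * q) q f) `^ ((1 - delta) / q) = N by rewrite ltr_pM2r.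
rewrite /N; case: cases => [[qp bm]|[dz|dI]].
(* The exponent relation forces [r = p] and then [c = -1], so all three integrals coincide and the
   two exponents add up to [1 / p]. *)
- have rp : r = p.
    move: drpq; rewrite qp -mulrDl -mulrDl addrC subrK mul1r => /(congr1 (fun y => y * p)).
    by rewrite divfK ?gt_eqF // mul1r.
  have cm : c = -1 by rewrite cE bm; ring.
  rewrite rp qp bm cm.
  have -> : alpha * -1 / p * p = - alpha by rewrite divfK ?gt_eqF // mulrN1.
  rewrite -powRD; first by congr (_ `^ _); field; rewrite gt_eqF.
  by apply/implyP => _; rewrite gt_eqF //; apply: (rV_int_gt0 (x0 := x0)); [exact: FC| |exact: Fgt0].
- have rq : r = q.
    move: drpq; rewrite dz !mul0r add0r subr0 mul1r => /(congr1 (fun y => y * q)).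
    by rewrite divfK ?gt_eqF // mul1r.
  (* A zeroth power is [1] for every base, so the first factor disappears. *)
  rewrite dz mul0r powRr0 mul1r subr0 mul1r rq; congr (rV_int (F _ _ _) `^ _).
  by rewrite cE dz; ring.
- have rp : r = p.
    move: drpq; rewrite dI subrr !mul0r addr0 mul1r => /(congr1 (fun y => y * p)).
    by rewrite divfK ?gt_eqF // mul1r.
  rewrite dI subrr !mul0r powRr0 mulr1 mul1r rp; congr (rV_int (F _ _ _) `^ _).
  rewrite cE dI; field; rewrite gt_eqF //.
Qed.
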